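(* The map $\mathbb B_{\mathrm{qcut}}\to\mathbb V_{\mathrm{fin}}(\overline K)$, $B^\bullet\mapsto\omega_{B^\bullet}$, is an isomorphism of posets.
   Context: $(K,v)$ valued field, $\overline K$ algebraic closure, $\bar v$ fixed extension of $v$ to $\overline K$, value group $\Gamma$. A quasi-cut in $\Gamma$ is a pair $\delta=(\delta^L,\delta^R)$ of subsets with $\delta^L\le\delta^R$ and $\delta^L\cup\delta^R=\Gamma$; $\operatorname{Qcuts}(\Gamma)$ is totally ordered by $\delta\le\epsilon\iff\delta^L\subseteq\epsilon^L$ and $\delta^R\supseteq\epsilon^R$. It is the disjoint union of $\Gamma$ (identifying $\gamma$ with $(\Gamma_{\le\gamma},\Gamma_{\ge\gamma})$) and the set $\operatorname{Cuts}(\Gamma)$ of cuts ($\delta^L<\delta^R$). For $a\in\overline K$: $B(a,\gamma)=\{c:\bar v(c-a)\ge\gamma\}$ if $\gamma\in\Gamma$, and $B(a,\delta)=\{c:\bar v(c-a)>\delta^L\}$ if $\delta$ is a cut. Pointed balls: $B^\bullet(a,\delta)=(B(a,\delta),\delta)$ for $\delta\in\operatorname{Qcuts}(\Gamma)$; $\mathbb B_{\mathrm{qcut}}$ is their set, ordered by $B^\bullet(a,\delta)\le B^\bullet(b,\epsilon)\iff B(a,\delta)\supseteq B(b,\epsilon)$ and $\delta\le\epsilon$. For $\delta\in\Gamma$ put $x_\delta=\delta$ and $\Gamma(\delta)=\Gamma$; for a cut $\delta$, $\Gamma(\delta)=x_\delta\mathbb Z\oplus\Gamma$ ordered with $\delta^L<x_\delta<\delta^R$.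 Then $\omega_{B^\bullet(a,\delta)}=\omega_{a,\delta}$, $\omega_{a,\delta}(\sum a_n(x-a)^n)=\min_n\{\bar v(a_n)+nx_\delta\}$. $\mathbb V_{\mathrm{fin}}(\overline K)$ is the set of equivalence classes of valuation-transcendental valuations on $\overline K(x)$ extending $\bar v$ (those that are residue-transcendental, i.e. with transcendental residue field extension, or value-transcendental, i.e. $\Gamma_\omega/\Gamma$ not torsion), with the partial order: $\mu\le\nu$ iff for every $f\in\overline K[x]$, $\mu(f)\le\nu(f)$, understood, for inequivalent $\mu,\nu$, as the existence of $\gamma\in\Gamma$ with $\mu(f)\le\gamma\le\nu(f)$. *)

(* Defs.v *)
From HB Require Import structures.
From mathcomp Require Import all_boot all_order all_algebra.
From Stdlib Require Import ClassicalEpsilon.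

Set Implicit Arguments.
Unset Strict Implicit.
Unset Printing Implicit Defensive.

Import GRing.Theory.
Local Open Scope ring_scope.

(* Ordered abelian groups (MathComp has no totally ordered Z-module     *)
(* structure with compatible order, so we use a plain record of         *)
(* operations together with a predicate stating the axioms).            *)
Record ogroup := OGroup {
  og_car :> Type;
  og_zero : og_car;
  og_add : og_car -> og_car -> og_car;
  og_opp : og_car -> og_car;
  og_le : og_car -> og_car -> Prop }.

Arguments og_zero {_}.
Arguments og_add {_}.
Arguments og_opp {_}.
Arguments og_le {_}.

Definition og_lt (G : ogroup) (x y : G) : Prop := og_le x y /\ x <> y.
Definition og_sub (G : ogroup) (x y : G) : G := og_add x (og_opp y).

Fixpoint og_muln (G : ogroup) (n : nat) (x : G) : G :=
  match n with O => og_zero | S m => og_add x (og_muln m x) end.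

Definition og_mulz (G : ogroup) (k : int) (x : G) : G :=
  match k with Posz n => og_muln n x | Negz n => og_opp (og_muln n.+1 x) end.

Definition is_ogroup (G : ogroup) : Prop :=
  [/\ (forall x y z : G, og_add x (og_add y z) = og_add (og_add x y) z),
      (forall x y : G, og_add x y = og_add y x),
      (forall x : G, og_add og_zero x = x),
      (forall x : G, og_add (og_opp x) x = og_zero) &
   [/\ (forall x : G, og_le x x),
       (forall x y : G, og_le x y -> og_le y x -> x = y),
       (forall x y z : G, og_le x y -> og_le y z -> og_le x z),
       (forall x y : G, og_le x y \/ og_le y x) &
       (forall x y z : G, og_le x y -> og_le (og_add x z) (og_add y z))]].

Definition is_oembedding (G H : ogroup) (i : G -> H) : Prop :=
  (forall x y, i (og_add x y) = og_add (i x) (i y)) /\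
  (forall x y, og_le x y <-> og_le (i x) (i y)).

Definition og_min (G : ogroup) (x y : G) : G :=
  if excluded_middle_informative (og_le x y) then x else y.

(* Valuations: w : R -> G, the value on 0 (i.e. infinity) is ignored.   *)
Definition is_valuation (R : fieldType) (G : ogroup) (w : R -> G) : Prop :=
  (forall x y : R, x != 0 -> y != 0 -> w (x * y) = og_add (w x) (w y)) /\
  (forall x y : R, x != 0 -> y != 0 -> x + y != 0 ->
     og_le (w x) (w (x + y)) \/ og_le (w y) (w (x + y))).

Section RatFun.
Variable L : fieldType.
Definition ratfun := {fraction {poly L}}.
Definition polyF (p : {poly L}) : ratfun := FracField.tofrac p.
Definition constF (a : L) : ratfun := polyF a%:P.
Definition evalF (P : {poly L}) (f : ratfun) : ratfun := (map_poly constF P).[f].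
End RatFun.

Record vx (L : fieldType) (G : ogroup) := VX {
  vgrp : ogroup;
  vemb : G -> vgrp;
  vval : ratfun L -> vgrp }.

Arguments vgrp {L G}.
Arguments vemb {L G}.
Arguments vval {L G}.

Section Vfin.
Variables (L : fieldType) (G : ogroup) (v : L -> G).

Definition is_ext_val (mu : vx L G) : Prop :=
  [/\ is_ogroup (vgrp mu), is_oembedding (vemb mu), is_valuation (vval mu) &
      forall a : L, a != 0 -> vval mu (constF a) = vemb mu (v a)].

Definition value_trans (mu : vx L G) : Prop :=
  exists f : ratfun L, f != 0 /\
    forall (n : nat) (g : G), (0 < n)%N -> og_muln n (vval mu f) <> vemb mu g.

(* residue-transcendental: some residue class fbar (f with mu f >= 0) is
   transcendental over the residue field k of v; i.e. for every polynomial P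
   with coefficients in the valuation ring of v whose reduction Pbar is
   nonzero (some coefficient is a unit), Pbar(fbar) = residue of P(f) is
   nonzero, i.e. P(f) <> 0 and mu(P(f)) <= 0. *)
Definition residue_trans (mu : vx L G) : Prop :=
  exists f : ratfun L, f != 0 /\ og_le og_zero (vval mu f) /\
    forall P : {poly L},
      (forall i, P`_i != 0 -> og_le og_zero (v P`_i)) ->
      (exists i, P`_i != 0 /\ v P`_i = og_zero) ->
      evalF P f != 0 /\ og_le (vval mu (evalF P f)) og_zero.

Definition valuation_trans (mu : vx L G) : Prop :=
  residue_trans mu \/ value_trans mu.

Definition vequiv (mu nu : vx L G) : Prop :=
  forall f : ratfun L, f != 0 ->
    (og_le og_zero (vval mu f) <-> og_le og_zero (vval nu f)).

Definition vle (mu nu : vx L G) : Prop :=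
  vequiv mu nu \/
  forall f : {poly L}, f != 0 ->
    exists g : G, og_le (vval mu (polyF f)) (vemb mu g) /\
                  og_le (vemb nu g) (vval nu (polyF f)).
End Vfin.

Inductive qcut (G : ogroup) :=
  | QElt of G
  | QCut of (G -> Prop) & (G -> Prop).

Arguments QElt {G}.
Arguments QCut {G}.

Definition is_qcut (G : ogroup) (d : qcut G) : Prop :=
  match d with
  | QElt _ => True
  | QCut dl dr => (forall x y, dl x -> dr y -> og_lt x y) /\
                  (forall x, dl x \/ dr x)
  end.

Definition qL (G : ogroup) (d : qcut G) : G -> Prop :=
  match d with QElt g => fun x => og_le x g | QCut dl _ => dl end.
Definition qR (G : ogroup) (d : qcut G) : G -> Prop :=
  match d with QElt g => fun x => og_le g x | QCut _ dr => dr end.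

Definition qcut_le (G : ogroup) (d e : qcut G) : Prop :=
  (forall x, qL d x -> qL e x) /\ (forall x, qR e x -> qR d x).
Definition qcut_eq (G : ogroup) (d e : qcut G) : Prop :=
  (forall x, qL d x <-> qL e x) /\ (forall x, qR d x <-> qR e x).

Section Balls.
Variables (L : fieldType) (G : ogroup) (v : L -> G).

(* B(a, delta) (c = a corresponds to v(c - a) = infinity) *)
Definition ball (a : L) (d : qcut G) (c : L) : Prop :=
  match d with
  | QElt g => c = a \/ og_le g (v (c - a))
  | QCut dl _ => c = a \/ (forall x, dl x -> og_lt x (v (c - a)))
  end.

Definition pball_le (a : L) (d : qcut G) (b : L) (e : qcut G) : Prop :=
  (forall c, ball b e c -> ball a d c) /\ qcut_le d e.
Definition pball_eq (a : L) (d : qcut G) (b : L) (e : qcut G) : Prop :=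
  (forall c, ball a d c <-> ball b e c) /\ qcut_eq d e.

(* The group Gamma(delta) = x_delta Z (+) Gamma for a cut delta, ordered *)
(* with deltaL < x_delta < deltaR: k x + b >= 0 iff                      *)
(*   k = 0 and b >= 0, or k > 0 and k g + b >= 0 for some g in deltaL,    *)
(*   or k < 0 and |k| g <= b for some g in deltaR.                        *)
Definition cut_nonneg (dl dr : G -> Prop) (z : int * G) : Prop :=
  let: (k, b) := z in
  if k == 0 then og_le og_zero b
  else if (0 < k) then exists g, dl g /\ og_le og_zero (og_add (og_mulz k g) b)
  else exists g, dr g /\ og_le (og_mulz (- k) g) b.

Definition cut_group (dl dr : G -> Prop) : ogroup :=
  @OGroup (int * G) (0, og_zero)
    (fun z w => (z.1 + w.1, og_add z.2 w.2))
    (fun z => (- z.1, og_opp z.2))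
    (fun z w => cut_nonneg dl dr (w.1 - z.1, og_sub w.2 z.2)).

Definition min_terms (H : ogroup) (N s : nat) (keep : nat -> bool)
  (t : nat -> H) : H :=
  foldr (fun n m => if keep n then og_min (t n) m else m) (t s) (iota 0 N).

(* omega_{a,delta} on polynomials: min_n { v(a_n) + n x_delta } where
   p = sum_n a_n (x - a)^n, i.e. a_n is the n-th coefficient of p(x + a). *)
Definition omega_poly (H : ogroup) (emb : G -> H) (xd : H) (a : L)
  (p : {poly L}) : H :=
  let q := p \Po ('X + a%:P) in
  min_terms (size q) (size q).-1 (fun n => q`_n != 0)
            (fun n => og_add (emb (v q`_n)) (og_muln n xd)).

Definition omega_frac (H : ogroup) (emb : G -> H) (xd : H) (a : L)
  (f : ratfun L) : H :=
  og_sub (omega_poly emb xd a (\n_(repr f))) (omega_poly emb xd a (\d_(repr f))).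

Definition omega (a : L) (d : qcut G) : vx L G :=
  match d with
  | QElt g => @VX L G G id (omega_frac id g a)
  | QCut dl dr =>
      @VX L G (cut_group dl dr) (fun g => (0, g))
        (omega_frac (H := cut_group dl dr) (fun g => (0, g)) (1, og_zero) a)
  end.
End Balls.

(* Main.v *)
(* Over an algebraically closed [L], a valuation of [L(x)] extending [v] is
   determined by its values on the polynomials [x - c], and
   [omega_{a,delta} (x - c) = min (delta, v (a - c))]; so [delta] and the ball
   [B(a, delta)] are read off from these values, and when [delta < epsilon]
   some [gamma] of [Gamma] lies between them, so that [omega_{b,gamma}] separates
   [omega_{b,delta}] from [omega_{b,epsilon}] on every polynomial.
   Conversely, for a valuation [mu], either some [a] maximizes [mu (x - a)], and
   then [mu] is [omega_{a,delta}] for the quasi-cut [delta] of [mu (x - a)], or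
   every rational function has the leading part of a constant of [L], and [mu]
   is not valuation-transcendental. *)
Require Import Defs.
From HB Require Import structures.
From mathcomp Require Import all_boot all_order all_algebra.
From mathcomp Require Import boolp zify ring generic_quotient.
From Stdlib Require Import ClassicalEpsilon.

Set Implicit Arguments.
Unset Strict Implicit.
Unset Printing Implicit Defensive.

Import Order.TTheory GRing.Theory Num.Theory.
Local Open Scope quotient_scope.
Local Open Scope ring_scope.

(** The valuations take values in different groups [Gamma(delta)], so two of them can be compared
    only through [Gamma], and the uniqueness statement holds up to an embedding of value groups.
    Since [v] maps onto [Gamma], dividing by constants turns equivalence, which sees only the sign
    of a value, into agreement of all comparisons with elements of [Gamma]. Such comparisons locate
    a value up to a quasi-cut of [Gamma], which is exactly the datum [delta] carried by [x_delta].
    Algebraic closedness acts twice: it splits polynomials into linear factors, and it makes [Gamma]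
    divisible. Divisibility makes the order of a cut group total, because [k x_delta + b] changes
    sign at an element of [Gamma], and that element lies on one side of the cut. It also makes a
    value outside [Gamma] independent of [Gamma], so that together they generate a copy of a cut
    group. *)

(* Alias carrying the zmodType structure of an ogroup, so that the lemmas on
   zmodTypes apply to ogroups up to conversion. *)
Definition og_zmod (H : ogroup) (HH : is_ogroup H) : Type := og_car H.

(** * Ordered abelian groups and their embeddings *)

Section ZmodOfOgroup.
Variables (H : ogroup) (HH : is_ogroup H).

HB.instance Definition _ := gen_eqMixin (og_zmod HH).
HB.instance Definition _ := gen_choiceMixin (og_zmod HH).

Let addA : associative (og_add : og_zmod HH -> og_zmod HH -> og_zmod HH).
Proof. by case: HH. Qed.
Let addC : commutative (og_add : og_zmod HH -> og_zmod HH -> og_zmod HH).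
Proof. by case: HH. Qed.
Let add0 : left_id (og_zero : og_zmod HH) og_add.
Proof. by case: HH. Qed.
Let addN : left_inverse (og_zero : og_zmod HH) (og_opp : og_zmod HH -> og_zmod HH) og_add.
Proof. by case: HH. Qed.

HB.instance Definition _ :=
  GRing.isZmodule.Build (og_zmod HH) addA addC add0 addN.

End ZmodOfOgroup.

Section OgroupTheory.
Variables (H : ogroup) (HH : is_ogroup H).
Implicit Types x y z t : H.
Notation Z := (og_zmod HH).

Lemma og_mulnE n x : og_muln n x = (x : Z) *+ n.
Proof. by elim: n => [|n IH] //=; rewrite mulrS IH. Qed.

Lemma og_mulzE k x : og_mulz k x = (x : Z) *~ k.
Proof. by case: k => n; rewrite /og_mulz og_mulnE. Qed.

Lemma og_addC x y : og_add x y = og_add y x.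
Proof. exact: (@addrC Z). Qed.
Lemma og_addA x y z : og_add x (og_add y z) = og_add (og_add x y) z.
Proof. exact: (@addrA Z). Qed.
Lemma og_addACA x y z t :
  og_add (og_add x y) (og_add z t) = og_add (og_add x z) (og_add y t).
Proof. exact: (@addrACA Z). Qed.
Lemma og_add0r x : og_add og_zero x = x.
Proof. exact: (@add0r Z). Qed.
Lemma og_addr0 x : og_add x og_zero = x.
Proof. exact: (@addr0 Z). Qed.
Lemma og_addNr x : og_add (og_opp x) x = og_zero.
Proof. exact: (@addNr Z). Qed.
Lemma og_subrr x : og_sub x x = og_zero.
Proof. exact: (@subrr Z). Qed.
Lemma og_addrK x y : og_sub (og_add x y) y = x.
Proof. exact: (@addrK Z). Qed.
Lemma og_subrK x y : og_add (og_sub x y) y = x.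
Proof. exact: (@subrK Z). Qed.
Lemma og_subr0 x : og_sub x og_zero = x.
Proof. exact: (@subr0 Z). Qed.
Lemma og_addIr x y z : og_add x z = og_add y z -> x = y.
Proof. exact: (@addIr Z). Qed.
Lemma og_subr_eq x y z t :
  og_add x t = og_add z y -> og_sub x y = og_sub z t.
Proof.
by move=> e; apply: (@og_addIr _ _ (og_add y t));
  rewrite og_addA og_subrK (og_addC y) og_addA og_subrK.
Qed.
Lemma og_opprK x : og_opp (og_opp x) = x.
Proof. exact: (@opprK Z). Qed.
Lemma og_oppr0 : og_opp og_zero = og_zero :> H.
Proof. exact: (@oppr0 Z). Qed.
Lemma og_opprD x y : og_opp (og_add x y) = og_add (og_opp x) (og_opp y).
Proof. exact: (@opprD Z). Qed.
Lemma og_opprB x y : og_opp (og_sub x y) = og_sub y x.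
Proof. exact: (@opprB Z). Qed.
Lemma og_subD x y z t :
  og_sub (og_add x y) (og_add z t) = og_add (og_sub x z) (og_sub y t).
Proof. by rewrite /og_sub -og_addACA; rewrite og_opprD. Qed.

Lemma og_mulnDr n x y : og_muln n (og_add x y) = og_add (og_muln n x) (og_muln n y).
Proof. by rewrite !og_mulnE; exact: (@mulrnDl Z). Qed.
Lemma og_mulnDl m n x : og_muln (m + n) x = og_add (og_muln m x) (og_muln n x).
Proof. by rewrite !og_mulnE; exact: (@mulrnDr Z). Qed.
Lemma og_mulzDl k l x : og_mulz (k + l) x = og_add (og_mulz k x) (og_mulz l x).
Proof. by rewrite !og_mulzE; exact: (@mulrzDr Z). Qed.
Lemma og_mulzN k x : og_mulz (- k) x = og_opp (og_mulz k x).
Proof. by rewrite !og_mulzE; exact: (@mulrNz Z). Qed.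

Lemma og_lexx x : og_le x x.
Proof. by case: HH => _ _ _ _ []. Qed.
Lemma og_le_anti x y : og_le x y -> og_le y x -> x = y.
Proof. by case: HH => _ _ _ _ [_ anti _ _ _]; apply: anti. Qed.
Lemma og_le_trans y x z : og_le x y -> og_le y z -> og_le x z.
Proof. by case: HH => _ _ _ _ [_ _ tr _ _]; apply: tr. Qed.
Lemma og_le_total x y : og_le x y \/ og_le y x.
Proof. by case: HH => _ _ _ _ [_ _ _ tot _]; apply: tot. Qed.
Lemma og_leD2r z x y : og_le (og_add x z) (og_add y z) <-> og_le x y.
Proof.
have mono : forall x y z, og_le x y -> og_le (og_add x z) (og_add y z).
  by case: HH => _ _ _ _ [].
split=> [/(mono _ _ (og_opp z))|/mono]; last exact.
by rewrite -!/(og_sub _ _) !og_addrK.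
Qed.
Lemma og_leD2l z x y : og_le (og_add z x) (og_add z y) <-> og_le x y.
Proof. by rewrite !(og_addC z) og_leD2r. Qed.
Lemma og_leD x y z t :
  og_le x y -> og_le z t -> og_le (og_add x z) (og_add y t).
Proof.
by move=> xy zt; apply: (@og_le_trans (og_add y z)); rewrite ?og_leD2r ?og_leD2l.
Qed.
Lemma og_ltNge x y : og_lt x y <-> ~ og_le y x.
Proof.
split=> [[xy ne] yx|nyx]; first exact/ne/og_le_anti.
by have [//|xy] := og_le_total y x; split=> // e;
  apply: nyx; rewrite e; apply: og_lexx.
Qed.
Lemma og_leVlt x y : og_le x y \/ og_lt y x.
Proof. by have [|h] := EM (og_le x y); [left|right; apply/og_ltNge]. Qed.
Lemma og_ltxx x : ~ og_lt x x.
Proof. by case. Qed.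
Lemma og_ltW x y : og_lt x y -> og_le x y.
Proof. by case. Qed.
Lemma og_lt_le_trans y x z : og_lt x y -> og_le y z -> og_lt x z.
Proof.
move=> /og_ltNge xy yz; apply/og_ltNge => zx; apply: xy.
exact: og_le_trans zx.
Qed.
Lemma og_ltD2r z x y : og_lt (og_add x z) (og_add y z) <-> og_lt x y.
Proof. by rewrite !og_ltNge og_leD2r. Qed.
Lemma og_lt_leD x y z t :
  og_lt x y -> og_le z t -> og_lt (og_add x z) (og_add y t).
Proof.
by move=> xy zt; apply: (@og_lt_le_trans (og_add y z)); rewrite ?og_ltD2r ?og_leD2l.
Qed.
Lemma og_sub_ge0 x y : og_le og_zero (og_sub x y) <-> og_le y x.
Proof. by rewrite -(og_leD2r y) og_subrK og_add0r. Qed.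
Lemma og_leN x y : og_le (og_opp x) (og_opp y) <-> og_le y x.
Proof.
by rewrite -(og_sub_ge0 (og_opp y)) -(og_sub_ge0 x) /og_sub og_opprK og_addC.
Qed.

Lemma og_min_lel x y : og_le (og_min x y) x.
Proof.
rewrite /og_min; case: excluded_middle_informative => h; first exact: og_lexx.
by have [] := og_le_total x y.
Qed.
Lemma og_min_ler x y : og_le (og_min x y) y.
Proof. by rewrite /og_min; case: excluded_middle_informative => // h; exact: og_lexx. Qed.
Lemma og_minP x y : og_min x y = x \/ og_min x y = y.
Proof. by rewrite /og_min; case: excluded_middle_informative; [left|right]. Qed.

Lemma og_muln_le n x y : og_le x y -> og_le (og_muln n x) (og_muln n y).
Proof. by move=> xy; elim: n => [|n IH]; [exact: og_lexx | exact: og_leD]. Qed.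
Lemma og_muln_lt n x y : (0 < n)%N -> og_lt x y -> og_lt (og_muln n x) (og_muln n y).
Proof. by case: n => // n _ xy; apply: og_lt_leD => //; exact/og_muln_le/og_ltW. Qed.
Lemma og_muln_leE n x y : (0 < n)%N -> og_le (og_muln n x) (og_muln n y) <-> og_le x y.
Proof.
move=> n0; split; last exact: og_muln_le.
by move=> h; have [//|/(og_muln_lt n0) /og_ltNge] := og_leVlt x y.
Qed.
Lemma og_muln_inj n x y : (0 < n)%N -> og_muln n x = og_muln n y -> x = y.
Proof.
by move=> n0 e; apply: og_le_anti; apply/(og_muln_leE _ _ n0); rewrite e; exact: og_lexx.
Qed.
Lemma og_muln0 n : og_muln n og_zero = og_zero :> H.
Proof. by rewrite og_mulnE; exact: (@mul0rn Z). Qed.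
Lemma og_mulz_le k x y : 0 <= k -> og_le x y -> og_le (og_mulz k x) (og_mulz k y).
Proof. by case: k => // n _; exact: og_muln_le. Qed.
Lemma og_mulz_lt k x y : 0 < k -> og_lt x y -> og_lt (og_mulz k x) (og_mulz k y).
Proof. by case: k => // n n0; exact: og_muln_lt. Qed.

End OgroupTheory.

Section Embeddings.
Variables (H K : ogroup) (HH : is_ogroup H) (HK : is_ogroup K).
Variables (i : H -> K) (Hi : is_oembedding i).
Implicit Types x y : H.

Lemma emb_add x y : i (og_add x y) = og_add (i x) (i y).
Proof. by case: Hi. Qed.
Lemma emb_le x y : og_le (i x) (i y) <-> og_le x y.
Proof. by case: Hi => _ ->. Qed.
Lemma emb_lt x y : og_lt (i x) (i y) <-> og_lt x y.
Proof. by rewrite !og_ltNge // emb_le. Qed.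
Lemma emb_inj : injective i.
Proof. by move=> x y e; apply: og_le_anti => //; apply/emb_le; rewrite e; apply: og_lexx. Qed.
Lemma emb0 : i og_zero = og_zero.
Proof.
by apply: (@og_addIr _ HK _ _ (i og_zero)); rewrite -emb_add !og_add0r.
Qed.
Lemma emb_sub x y : i (og_sub x y) = og_sub (i x) (i y).
Proof.
by apply: (@og_addIr _ HK _ _ (i y)); rewrite -emb_add !og_subrK.
Qed.
Lemma emb_muln n x : i (og_muln n x) = og_muln n (i x).
Proof. by elim: n => [|n IH] /=; rewrite ?emb0 // emb_add IH. Qed.
Lemma emb_mulz k x : i (og_mulz k x) = og_mulz k (i x).
Proof.
case: k => n; first exact: emb_muln.
have e : forall (X : ogroup) (HX : is_ogroup X) (x : X),
    og_opp x = og_sub og_zero x by move=> X HX z; rewrite /og_sub og_add0r.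
by rewrite /og_mulz !(e _ HH, e _ HK) emb_sub emb0 emb_muln.
Qed.
End Embeddings.

(** * The ordered group of a cut *)

Section CutGroup.
Variables (G : ogroup) (HG : is_ogroup G).
Hypothesis Gdiv : forall (n : nat) (g : G), (0 < n)%N ->
  exists h, og_muln n h = g.
Variables (dl dr : G -> Prop).
Hypothesis (dlr : forall x y, dl x -> dr y -> og_lt x y)
           (dlVr : forall x, dl x \/ dr x).
Implicit Types (x y g h : G) (z w : int * G).

Lemma cut_down x y : og_le x y -> dl y -> dl x.
Proof.
move=> xy dy; have [//|dx] := dlVr x.
by have /(og_ltNge HG) := dlr dy dx.
Qed.

Lemma cut_up x y : og_le x y -> dr x -> dr y.
Proof.
move=> xy dx; have [dy|//] := dlVr y.
by have /(og_ltNge HG) := dlr dy dx.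
Qed.

(** This substitutes [g] for [x_delta]. The result is monotone in [g], increasing or decreasing with
    the sign of [k], so for [k != 0] nonnegativity in the cut group is nonnegativity at some [g] on
    the side prescribed by that sign. *)
Let ev g z := og_add (og_mulz z.1 g) z.2.

Let evD g z w : ev g (z.1 + w.1, og_add z.2 w.2) = og_add (ev g z) (ev g w).
Proof. by rewrite /ev /= og_mulzDl // og_addACA. Qed.

Local Notation pos := (cut_nonneg dl dr).
Local Arguments cut_nonneg : simpl never.

Let pos0 b : pos (0, b) <-> og_le og_zero b.
Proof. by []. Qed.

Let pos_gt k b : 0 < k ->
  pos (k, b) <-> exists g, dl g /\ og_le og_zero (ev g (k, b)).
Proof. by move=> k0; rewrite /cut_nonneg gt_eqF // k0. Qed.

Let pos_lt k b : k < 0 ->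
  pos (k, b) <-> exists g, dr g /\ og_le og_zero (ev g (k, b)).
Proof.
move=> k0; rewrite /cut_nonneg lt_eqF // ltNge ltW //=.
have e g : og_le (og_mulz (- k) g) b <-> og_le og_zero (ev g (k, b)).
  by rewrite -(og_sub_ge0 HG b) /og_sub og_mulzN // og_opprK // og_addC.
by split=> -[g [dg /e h]]; exists g.
Qed.

Let ev_ge k b g h : 0 <= k -> og_le g h -> og_le (ev g (k, b)) (ev h (k, b)).
Proof. by move=> k0 gh; apply/og_leD2r => //; exact: og_mulz_le. Qed.

Let evN g z : ev g (- z.1, og_opp z.2) = og_opp (ev g z).
Proof.
by rewrite /ev /= og_mulzN //; rewrite og_opprD.
Qed.

Let ev_le k b g h : k <= 0 -> og_le g h -> og_le (ev h (k, b)) (ev g (k, b)).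
Proof.
move=> k0 gh; apply/og_leD2r => //=.
rewrite -[k]opprK !(og_mulzN HG (- k)); apply/og_leN => //.
by apply: og_mulz_le; rewrite ?oppr_ge0.
Qed.

(** A witness can be brought into [dl], at or above [g]: by monotonicity for positive slope, and for
    negative slope because [dr] lies above [dl]. Two nonnegative elements thus get a common point at
    which they can be added. *)
Let near_dl z g : pos z -> dl g ->
  exists h, [/\ dl h, og_le g h & og_le og_zero (ev h z)].
Proof.
case: z => k b; case: (ltgtP k 0) => [k0|k0|->].
- move/(pos_lt _ k0) => [r [dr_r r0]] dg; exists g;
  split=> //; first exact: og_lexx.
  apply: og_le_trans r0 _ => //; apply: ev_le; first exact: ltW.
  exact/og_ltW/dlr.
- move/(pos_gt _ k0) => [l [dl_l l0]] dg.
  have [gl|lg] := og_le_total HG g l; first by exists l.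
  exists g; split=> //; first exact: og_lexx.
  by apply: og_le_trans l0 _ => //; apply: ev_ge => //; exact: ltW.
- move=> b0 dg; exists g; split=> //; first exact: og_lexx.
  by rewrite /ev /= og_add0r.
Qed.

Let near_dr z g : pos z -> dr g ->
  exists h, [/\ dr h, og_le h g & og_le og_zero (ev h z)].
Proof.
case: z => k b; case: (ltgtP k 0) => [k0|k0|->].
- move/(pos_lt _ k0) => [l [dl_l l0]] dg.
  have [gl|lg] := og_le_total HG l g; first by exists l.
  exists g; split=> //; first exact: og_lexx.
  by apply: og_le_trans l0 _ => //; apply: ev_le => //; exact: ltW.
- move/(pos_gt _ k0) => [r [dr_r r0]] dg; exists g;
  split=> //; first exact: og_lexx.
  apply: og_le_trans r0 _ => //; apply: ev_ge; first exact: ltW.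
  exact/og_ltW/dlr.
- move=> b0 dg; exists g; split=> //; first exact: og_lexx.
  by rewrite /ev /= og_add0r.
Qed.

Let pos_of_dl z g : 0 <= z.1 -> dl g -> og_le og_zero (ev g z) -> pos z.
Proof.
case: z => k b /=; rewrite le_eqVlt => /orP[/eqP <-|k0] dg g0.
  by apply/pos0; move: g0; rewrite /ev /= og_add0r.
by apply/pos_gt => //; exists g.
Qed.

Let pos_of_dr z g : z.1 <= 0 -> dr g -> og_le og_zero (ev g z) -> pos z.
Proof.
case: z => k b /=; rewrite le_eqVlt => /orP[/eqP ->|k0] dg g0.
  by apply/pos0; move: g0; rewrite /ev /= og_add0r.
by apply/pos_lt => //; exists g.
Qed.

Let add_ge0 x y : og_le og_zero x -> og_le og_zero y -> og_le og_zero (og_add x y).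
Proof. by move=> x0 y0; rewrite -(og_add0r HG og_zero); exact: og_leD. Qed.

Let pos_add_gt z w : 0 < z.1 -> 0 <= z.1 + w.1 -> pos z -> pos w ->
  pos (z.1 + w.1, og_add z.2 w.2).
Proof.
case: z => k b k0 s0 /(pos_gt _ k0)[g [dg g0]] /near_dl -/(_ g dg)[h [dh gh h0]].
apply: (@pos_of_dl _ h) => //; rewrite (evD h (k, b)); apply: add_ge0 => //.
by apply: og_le_trans g0 _ => //; apply: ev_ge => //; exact: ltW.
Qed.

Let pos_add_lt z w : z.1 < 0 -> z.1 + w.1 <= 0 -> pos z -> pos w ->
  pos (z.1 + w.1, og_add z.2 w.2).
Proof.
case: z => k b k0 s0 /(pos_lt _ k0)[g [dg g0]] /near_dr -/(_ g dg)[h [dh gh h0]].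
apply: (@pos_of_dr _ h) => //; rewrite (evD h (k, b)); apply: add_ge0 => //.
by apply: og_le_trans g0 _ => //; apply: ev_le => //; exact: ltW.
Qed.

Let pos_add z w : pos z -> pos w -> pos (z.1 + w.1, og_add z.2 w.2).
Proof.
(* If the sum has slope at least 0, the summand of larger slope supplies the common point; otherwise
   the one of smaller slope does. *)
wlog zw : z w / z.1 <= w.1 => [ih pz pw|pz pw].
  have [/ih|/ltW/ih] := leP z.1 w.1; first exact.
  by rewrite addrC og_addC //; apply.
have [s0|s0] := leP 0 (z.1 + w.1).
  have [w0|w0] := ltP 0 w.1.
    by rewrite addrC og_addC //; apply: pos_add_gt => //; rewrite addrC.
  have w00 : w.1 = 0 by lia.
  have z00 : z.1 = 0 by lia.
  case: z w pz pw w00 z00 {zw s0 w0} => [k b] [l c] /= pz pw e1 e2.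
  by move: pz pw; rewrite e1 e2; exact: add_ge0.
by apply: pos_add_lt => //; [lia|exact: ltW].
Qed.

Let pos_anti z : pos z -> pos (- z.1, og_opp z.2) -> z = (0, og_zero).
Proof.
have main k b : 0 < k -> pos (k, b) -> ~ pos (- k, og_opp b).
  move=> k0 /(pos_gt _ k0)[g [dg g0]] /(pos_lt).
  rewrite oppr_lt0 => /(_ k0)[h [dh h0]].
  (* Substitution is strictly increasing for [k > 0], so the value at [g] is below the value at [h],
     whereas the first is nonnegative and the second nonpositive. *)
  have gh := dlr dg dh.
  apply: (@og_ltxx _ (og_add (ev g (k, b)) (ev h (- k, og_opp b)))).
  apply: (@og_lt_le_trans _ HG og_zero); last exact: add_ge0.
  rewrite (evN h (k, b)) -/(og_sub _ _) -(og_subrr HG (ev h (k, b))).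
  apply/og_ltD2r => //; apply/og_ltD2r => //; exact: og_mulz_lt.
case: z => k b; case: (ltgtP k 0) => [k0|k0|->] pz pN.
- exfalso; apply: (main (- k) (og_opp b)) => //; first by rewrite oppr_gt0.
  by rewrite opprK og_opprK.
- by case: (main k b).
- congr pair; apply: og_le_anti => //; apply/(og_sub_ge0 HG).
  by rewrite /og_sub og_add0r //; move: pN; rewrite oppr0.
Qed.

Let ev0 k b : k != 0 -> exists h, ev h (k, b) = og_zero.
Proof.
case: k => n k0.
  have [|h e] := @Gdiv n (og_opp b); first by rewrite lt0n.
  by exists h; rewrite /ev /= e og_addNr.
have [//|h e] := @Gdiv n.+1 b.
by exists h; rewrite /ev [og_mulz _ _]/(og_opp (og_muln n.+1 h)) e og_addNr.
Qed.

(** The zero [h] of [k x + b] lies on one side of the cut. Both [z] and its opposite vanish there,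
    and the sign of [k] tells which of them admits a witness on that side. *)
Let pos_total z : pos z \/ pos (- z.1, og_opp z.2).
Proof.
case: z => k b; rewrite -[(k, b).1]/k -[(k, b).2]/b; have [->|k0] := eqVneq k 0.
  rewrite oppr0; have [h|h] := og_le_total HG og_zero b; [by left|right].
  by apply/pos0; move/(og_sub_ge0 HG): h; rewrite /og_sub og_add0r.
have [h e] := ev0 b k0.
have eN : ev h (- k, og_opp b) = og_zero.
  by rewrite (evN h (k, b)) e; rewrite og_oppr0.
have [hl|hr] := dlVr h; case: (ltgtP k 0) k0 => // k0 _.
- right; apply: (@pos_of_dl _ h); rewrite /= ?oppr_ge0 ?ltW // eN; exact: og_lexx.
- left; apply: (@pos_of_dl _ h); rewrite /= ?ltW // e; exact: og_lexx.
- left; apply: (@pos_of_dr _ h); rewrite /= ?ltW // e; exact: og_lexx.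
- right; apply: (@pos_of_dr _ h); rewrite /= ?oppr_le0 ?ltW // eN; exact: og_lexx.
Qed.

Lemma cut_group_is_ogroup : is_ogroup (cut_group dl dr).
Proof.
have oppsub z w : (- (w.1 - z.1), og_opp (og_sub w.2 z.2)) =
    (z.1 - w.1, og_sub z.2 w.2).
  by rewrite opprB; congr pair; rewrite og_opprB.
split; [| | | |split] => /=.
- by move=> x y z; rewrite addrA og_addA.
- by move=> x y; rewrite addrC og_addC.
- by move=> [k b] /=; rewrite add0r og_add0r.
- by move=> [k b] /=; rewrite addNr og_addNr.
- by move=> x; rewrite subrr og_subrr // ; apply/pos0; exact: og_lexx.
- move=> z w h1 h2; have := pos_anti h1; rewrite oppsub => /(_ h2)[e1 e2].
  case: z w e1 e2 {h1 h2} => [k b] [l c] /= e1 e2; congr pair; first by lia.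
  by apply: (@og_addIr _ HG _ _ (og_opp b)); rewrite -!/(og_sub _ _) e2 og_subrr.
- move=> x y z h1 h2; have /= := pos_add h1 h2.
  rewrite [_ + _](_ : _ = z.1 - x.1); last by lia.
  by rewrite -og_subD // og_addC // og_subD // og_subrr // og_addr0.
- by move=> x y; have := pos_total (y.1 - x.1, og_sub y.2 x.2); rewrite oppsub.
- move=> x y z h; rewrite og_subD // og_subrr // og_addr0 //.
  by rewrite (_ : _ - _ = y.1 - x.1) //; lia.
Qed.
End CutGroup.

(** * Ultrametric inequality, valuations and leading parts *)

Section Ultrametric.
Variables (R : fieldType) (H : ogroup) (HH : is_ogroup H) (w : R -> H).
Hypothesis wD : forall x y : R, x != 0 -> y != 0 -> x + y != 0 ->
  og_le (w x) (w (x + y)) \/ og_le (w y) (w (x + y)).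
Implicit Types (x y : R) (z : H).

(* The value of [0] is junk, so these stand for [z <= w x] and [z < w x] with
   the convention [w 0 = oo]. *)
Definition vge z x := x = 0 \/ og_le z (w x).
Definition vgt z x := x = 0 \/ og_lt z (w x).

Lemma vge0 z : vge z 0. Proof. by left. Qed.
Lemma vgt0 z : vgt z 0. Proof. by left. Qed.

Lemma vgeD z x y : vge z x -> vge z y -> vge z (x + y).
Proof.
move=> [->|zx]; first by rewrite add0r.
move=> [->|zy]; first by rewrite addr0; right.
have [->|x0] := eqVneq x 0; first by rewrite add0r; right.
have [->|y0] := eqVneq y 0; first by rewrite addr0; right.
have [->|xy0] := eqVneq (x + y) 0; first by left.
by right; have [h|h] := wD x0 y0 xy0; apply: og_le_trans h.
Qed.

Lemma vgtD z x y : vgt z x -> vgt z y -> vgt z (x + y).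
Proof.
move=> [->|zx]; first by rewrite add0r.
move=> [->|zy]; first by rewrite addr0; right.
have [->|x0] := eqVneq x 0; first by rewrite add0r; right.
have [->|y0] := eqVneq y 0; first by rewrite addr0; right.
have [->|xy0] := eqVneq (x + y) 0; first by left.
by right; have [h|h] := wD x0 y0 xy0; apply: og_lt_le_trans h.
Qed.

Hypothesis wN : forall x, x != 0 -> w (- x) = w x.

Lemma vgeN z x : vge z x -> vge z (- x).
Proof.
have [->|x0] := eqVneq x 0; first by rewrite oppr0.
by case=> [e|h]; right; rewrite wN //; rewrite e eqxx in x0.
Qed.

Lemma vgtN z x : vgt z x -> vgt z (- x).
Proof.
have [->|x0] := eqVneq x 0; first by rewrite oppr0.
by case=> [e|h]; right; rewrite wN //; rewrite e eqxx in x0.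
Qed.

Lemma val_add_gt x y : x != 0 -> vgt (w x) y ->
  x + y != 0 /\ w (x + y) = w x.
Proof.
move=> x0 [->|xy]; first by rewrite addr0.
have [->|y0] := eqVneq y 0; first by rewrite addr0.
have xy0 : x + y != 0.
  by apply: contra_not_neq (@og_ltxx _ (w x)) => /eqP; rewrite addr_eq0 => /eqP e;
    rewrite {2}e wN.
split=> //; apply: og_le_anti => //; last first.
  by have [//|h] := wD x0 y0 xy0; apply: og_le_trans h => //; apply: og_ltW.
have := wD xy0 (_ : - y != 0); rewrite addrK oppr_eq0 wN // => /(_ y0 x0)[//|h].
by have /og_ltNge := xy; case.
Qed.
End Ultrametric.

Section Valuation.
Variables (R : fieldType) (H : ogroup) (HH : is_ogroup H) (w : R -> H).
Hypothesis Hw : is_valuation w.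
Implicit Types x y : R.

Lemma valuationM x y : x != 0 -> y != 0 -> w (x * y) = og_add (w x) (w y).
Proof. by case: Hw => + _; apply. Qed.

Lemma valuationD x y : x != 0 -> y != 0 -> x + y != 0 ->
  og_le (w x) (w (x + y)) \/ og_le (w y) (w (x + y)).
Proof. by case: Hw => _; apply. Qed.

Lemma valuation1 : w 1 = og_zero.
Proof.
by apply: (@og_addIr _ HH _ _ (w 1)); rewrite -valuationM ?oner_eq0 // mulr1 og_add0r.
Qed.

Lemma valuationN x : x != 0 -> w (- x) = w x.
Proof.
move=> x0; rewrite -mulN1r valuationM ?oppr_eq0 ?oner_eq0 //.
rewrite (_ : w (-1) = og_zero) ?og_add0r //.
(* An ordered group has no torsion, and twice the value of [-1] is the value of [1]. *)
apply: (@og_muln_inj _ HH 2) => //; rewrite og_muln0 //= og_addr0 //.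
by rewrite -valuationM ?oppr_eq0 ?oner_eq0 // mulN1r opprK valuation1.
Qed.

Lemma valuationV x : x != 0 -> w x^-1 = og_opp (w x).
Proof.
move=> x0; apply: (@og_addIr _ HH _ _ (w x)).
by rewrite -valuationM ?invr_eq0 // mulVf // og_addNr // valuation1.
Qed.

Lemma valuationX x n : x != 0 -> w (x ^+ n) = og_muln n (w x).
Proof.
by move=> x0; elim: n => [|n IH]; rewrite ?valuation1 // exprS valuationM ?expf_neq0 // IH.
Qed.
End Valuation.

Section Approximation.
Variables (R : fieldType) (H : ogroup) (HH : is_ogroup H) (w : R -> H).
Hypothesis Hw : is_valuation w.
Implicit Types f g u t : R.

Lemma vgtM z f g : g != 0 -> vgt w z f -> vgt w (og_add z (w g)) (f * g).
Proof.
move=> g0; have [->|f0] := eqVneq f 0; first by rewrite mul0r; left.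
case=> [/eqP e|h]; first by rewrite (negPf f0) in e.
by right; rewrite (valuationM Hw) //; apply/og_ltD2r.
Qed.

(* [f] and [u] have the same leading part: [f / u] has residue [1]. *)
Definition approx f u := u != 0 /\ vgt w (w f) (f - u).

Lemma approx_val f u : f != 0 -> approx f u -> w u = w f.
Proof.
move=> f0 [u0 h].
have [_] := val_add_gt HH (valuationD Hw) (valuationN HH Hw) f0
  (vgtN (valuationN HH Hw) h).
by rewrite opprB addrC subrK.
Qed.

Lemma approxM f g u t : f != 0 -> g != 0 ->
  approx f u -> approx g t -> approx (f * g) (u * t).
Proof.
move=> f0 g0 fu gt; have [[u0 hu] [t0 ht]] := (fu, gt).
split; first exact: mulf_neq0.
rewrite (valuationM Hw f0 g0).
have -> : f * g - u * t = (f - u) * g + (g - t) * u by ring.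
apply: (vgtD HH (valuationD Hw)); first exact: vgtM.
by rewrite og_addC // -(approx_val f0 fu); exact: vgtM.
Qed.

Lemma approxV f u : f != 0 -> approx f u -> approx f^-1 u^-1.
Proof.
move=> f0 fu; have [u0 hu] := fu; split; first exact: invr_neq0.
have -> : f^-1 - u^-1 = - (f - u) * (f * u)^-1.
  by field; rewrite u0 f0.
have fu0 : f * u != 0 by exact: mulf_neq0.
rewrite (valuationV HH Hw f0).
have -> : og_opp (w f) = og_add (w f) (w (f * u)^-1).
  rewrite (valuationV HH Hw fu0) (valuationM Hw f0 u0) (approx_val f0 fu).
  by rewrite og_opprD // og_addA // -/(og_sub (w f) (w f)) og_subrr // og_add0r.
apply: vgtM; first exact: invr_neq0.
exact: (vgtN (valuationN HH Hw)).
Qed.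
End Approximation.

(** * Gauss valuations on polynomials *)

Section MinTerms.
Variables (H : ogroup) (HH : is_ogroup H).

Lemma min_terms_le N s (keep : nat -> bool) (t : nat -> H) n :
  n = s \/ (n < N)%N /\ keep n -> og_le (min_terms N s keep t) (t n).
Proof.
rewrite /min_terms => h.
have : n = s \/ n \in iota 0 N /\ keep n.
  by rewrite mem_iota add0n /=.
elim: (iota 0 N) => [|m r IH] /= {}h.
  by case: h => [->|[]] //; exact: og_lexx.
set M := foldr _ _ r in IH *.
have step : og_le (if keep m then og_min (t m) M else M) M.
  by case: ifP => _; [exact: og_min_ler | exact: og_lexx].
case: h => [e|[+ kn]]; first by apply: og_le_trans step _ => //; apply: IH; left.
rewrite inE => /orP[/eqP <-|nr]; first by rewrite kn; exact: og_min_lel.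
by apply: og_le_trans step _ => //; apply: IH; right.
Qed.

Lemma min_terms_ex N s (keep : nat -> bool) (t : nat -> H) :
  exists n, (n = s \/ keep n) /\ min_terms N s keep t = t n.
Proof.
rewrite /min_terms; elim: (iota 0 N) => [|m r [n [kn e]]] /=.
  by exists s; split; [left|].
case: ifP => km; last by exists n.
rewrite e; have [->|->] := og_minP (t m) (t n); last by exists n.
by exists m; split; [right|].
Qed.
End MinTerms.

Section Gauss.
Variables (L : fieldType) (G H : ogroup) (HG : is_ogroup G) (HH : is_ogroup H).
Variables (v : L -> G) (Hv : is_valuation v).
Variables (emb : G -> H) (Hemb : is_oembedding emb) (xd : H).
Implicit Types p q : {poly L}.

Definition gterm q n : H := og_add (emb (v q`_n)) (og_muln n xd).
Definition gauss q : H :=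
  min_terms (size q) (size q).-1 (fun n => q`_n != 0) (gterm q).

Lemma gauss_le q n : q`_n != 0 -> og_le (gauss q) (gterm q n).
Proof.
move=> qn; apply: min_terms_le => //; right; split=> //.
by rewrite ltnNge; apply: contra qn => h; rewrite nth_default.
Qed.

(** The fold starts from the term of the leading coefficient, which is a genuine term when [q != 0],
    so the default is harmless. *)
Lemma gauss_ex q : q != 0 -> exists n, q`_n != 0 /\ gauss q = gterm q n.
Proof.
move=> q0; have [n [[->|h] e]] := 
    min_terms_ex (size q) (size q).-1 (fun n => q`_n != 0) (gterm q).
  by exists (size q).-1; rewrite -[_`_ _]/(lead_coef q) lead_coef_eq0.
by exists n.
Qed.

Lemma gauss_ge q z : q != 0 ->
  (forall n, q`_n != 0 -> og_le z (gterm q n)) -> og_le z (gauss q).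
Proof. by move=> /gauss_ex[n [qn ->]]; apply. Qed.

Lemma gauss_first q : q != 0 -> exists n, [/\ q`_n != 0, gauss q = gterm q n &
  forall m, (m < n)%N -> q`_m != 0 -> og_lt (gauss q) (gterm q m)].
Proof.
move=> /gauss_ex[n0 h0].
have ex : exists n, `[< q`_n != 0 /\ gauss q = gterm q n >] by exists n0; apply/asboolP.
case: (ex_minnP ex) => n /asboolP[qn e] min; exists n; split=> // m mn qm.
split; first exact: gauss_le.
by move=> em; have := min m; rewrite leqNgt mn => /(_ (asboolT (conj qm em))).
Qed.

(** In a fixed degree [n] a term is a translate of [v]: it obeys the ultrametric inequality but need
    not be multiplicative. The lemmas on [vge] and [vgt] are stated so as to cover such
    functions. *)
Let vt n (c : L) : H := og_add (emb (v c)) (og_muln n xd).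

Let vtD n (x y : L) : x != 0 -> y != 0 -> x + y != 0 ->
  og_le (vt n x) (vt n (x + y)) \/ og_le (vt n y) (vt n (x + y)).
Proof. by rewrite /vt !og_leD2r // !emb_le //; exact: valuationD. Qed.

Let vtN n (x : L) : x != 0 -> vt n (- x) = vt n x.
Proof. by move=> x0; rewrite /vt (valuationN HG). Qed.

Let vtM p q i j : p`_i != 0 -> q`_j != 0 ->
  vt (i + j) (p`_i * q`_j) = og_add (gterm p i) (gterm q j).
Proof.
by move=> pi qj; rewrite /vt /gterm valuationM // emb_add // og_mulnDl // og_addACA.
Qed.

Lemma gaussD p q : p != 0 -> q != 0 -> p + q != 0 ->
  og_le (gauss p) (gauss (p + q)) \/ og_le (gauss q) (gauss (p + q)).
Proof.
move=> p0 q0 pq0.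
have main z : og_le z (gauss p) -> og_le z (gauss q) -> og_le z (gauss (p + q)).
  move=> zp zq; apply: gauss_ge => // n.
  have : vge (vt n) z (p + q)`_n.
    rewrite coefD; apply: (vgeD HH (@vtD n)).
      have [->|pn] := eqVneq p`_n 0; first exact: vge0.
      by right; apply: og_le_trans (gauss_le pn).
    have [->|qn] := eqVneq q`_n 0; first exact: vge0.
    by right; apply: og_le_trans (gauss_le qn).
  by case=> // ->; rewrite eqxx.
have [pq|qp] := og_le_total HH (gauss p) (gauss q).
  by left; apply: main => //; exact: og_lexx.
by right; apply: main => //; exact: og_lexx.
Qed.

(* With [i], [j] the first indices at which [p], [q] attain their minima, the
   coefficient of index [i + j] of [p * q] is [p_i * q_j] plus terms of larger
   value. *)
Lemma gaussM p q : p != 0 -> q != 0 ->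
  gauss (p * q) = og_add (gauss p) (gauss q).
Proof.
move=> p0 q0; have pq0 : p * q != 0 by rewrite mulf_neq0.
apply: og_le_anti => //; last first.
  apply: gauss_ge => // n.
  suff : vge (vt n) (og_add (gauss p) (gauss q)) (p * q)`_n.
    by case=> // ->; rewrite eqxx.
  rewrite coefM; apply: (big_ind (vge (vt n) _)); first exact: vge0.
    by move=> x y; exact: (vgeD HH (@vtD n)).
  move=> k _; have [->|pk] := eqVneq p`_k 0; first by rewrite mul0r; exact: vge0.
  have [->|qk] := eqVneq q`_(n - k) 0; first by rewrite mulr0; exact: vge0.
  have kn : (k <= n)%N by rewrite -ltnS.
  by right; rewrite -[vt n](congr1 vt (subnKC kn)) vtM //; apply: og_leD => //; exact: gauss_le.
have [i [pi ei mi]] := gauss_first p0.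
have [j [qj ej mj]] := gauss_first q0.
have pqij : p`_i * q`_j != 0 by rewrite mulf_neq0.
have lt_iS : (i < (i + j).+1)%N by rewrite ltnS leq_addr.
pose r := \sum_(k < (i + j).+1 | k != Ordinal lt_iS) p`_k * q`_(i + j - k).
have er : (p * q)`_(i + j) = p`_i * q`_j + r.
  by rewrite coefM (bigD1 (Ordinal lt_iS)) //= addKn.
have hr : vgt (vt (i + j)) (vt (i + j) (p`_i * q`_j)) r.
  apply: (big_ind (vgt (vt (i + j)) _)); first exact: vgt0.
    by move=> x y; exact: (vgtD HH (@vtD (i + j))).
  move=> k; rewrite -val_eqE /= => ki.
  have [->|pk] := eqVneq p`_k 0; first by rewrite mul0r; exact: vgt0.
  have [->|qk] := eqVneq q`_(i + j - k) 0; first by rewrite mulr0; exact: vgt0.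
  have kij : (k <= i + j)%N by rewrite -ltnS.
  right; rewrite vtM // -[vt _](congr1 vt (subnKC kij)) vtM // -ei -ej.
  have [lt_ki|le_ik] := ltnP k i.
    by apply: og_lt_leD => //; [exact: mi | exact: gauss_le].
  rewrite (og_addC HH (gauss p)) (og_addC HH (gterm p k)).
  apply: og_lt_leD => //; last exact: gauss_le.
  by apply: mj => //; lia.
have [n0 e] := val_add_gt HH (@vtD (i + j)) (@vtN (i + j)) pqij hr.
rewrite -er in n0 e; apply: og_le_trans (gauss_le n0) _ => //.
by rewrite [gterm _ _]e vtM // ei ej; exact: og_lexx.
Qed.

End Gauss.

(** * Rational functions and the valuations [omega_{a,delta}] *)

Section RatFun.
Variable L : fieldType.
Implicit Types (p q : {poly L}) (f : ratfun L).

HB.instance Definition _ := GRing.RMorphism.copy (@polyF L) (@FracField.tofrac {poly L}).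
HB.instance Definition _ := GRing.RMorphism.copy (@constF L)
  (@FracField.tofrac {poly L} \o (@polyC L)).

Lemma polyF_eq0 p : (polyF p == 0) = (p == 0).
Proof. exact: tofrac_eq0. Qed.

Lemma polyFM p q : polyF (p * q) = polyF p * polyF q.
Proof. exact: rmorphM. Qed.

Lemma polyF_inj : injective (@polyF L).
Proof. by move=> p q /eqP; rewrite tofrac_eq => /eqP. Qed.

Lemma constF_eq0 (a : L) : (constF a == 0) = (a == 0).
Proof. by rewrite polyF_eq0 polyC_eq0. Qed.

Lemma denom_repr_neq0 f : \d_(repr f) != 0.
Proof. exact: denom_ratioP. Qed.

Lemma numden_repr f : f * polyF \d_(repr f) = polyF \n_(repr f).
Proof.
have h (x : {ratio {poly L}}) :
    \pi_(ratfun L) x * polyF \d_x = polyF \n_x.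
  rewrite /polyF -[_ * _]/(FracField.mul _ _) !piE; apply/eqmodP.
  rewrite /= FracField.equivfE /FracField.mulf.
  by rewrite !numden_Ratio ?oner_eq0 ?mulr1 ?denom_ratioP // mulrC.
by rewrite -{1}[f]reprK; exact: h.
Qed.

Lemma evalF_polyF (P r : {poly L}) : evalF P (polyF r) = polyF (P \Po r).
Proof.
rewrite /evalF /comp_poly -horner_map -map_poly_comp.
by congr (_ .[_]); apply: eq_map_poly.
Qed.
End RatFun.

Section Omega.
Variables (L : fieldType) (G H : ogroup) (HG : is_ogroup G) (HH : is_ogroup H).
Variables (v : L -> G) (Hv : is_valuation v).
Variables (emb : G -> H) (Hemb : is_oembedding emb) (xd : H) (a : L).
Implicit Types (p q : {poly L}) (f : ratfun L) (z : H).

Let sh p := p \Po ('X + a%:P).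
Let W p := gauss v emb xd (sh p).
Let om := omega_frac v emb xd a.

Let sh_eq0 p : (sh p == 0) = (p == 0).
Proof. by rewrite -!size_poly_eq0 size_comp_poly2 // size_XaddC. Qed.

Let WM p q : p != 0 -> q != 0 -> W (p * q) = og_add (W p) (W q).
Proof. by move=> p0 q0; rewrite /W /sh comp_polyM gaussM // sh_eq0. Qed.

Let WD p q : p != 0 -> q != 0 -> p + q != 0 ->
  og_le (W p) (W (p + q)) \/ og_le (W q) (W (p + q)).
Proof.
move=> p0 q0 pq0; have : sh (p + q) != 0 by rewrite sh_eq0.
by rewrite /W /sh comp_polyD => ?; apply: gaussD; rewrite // sh_eq0.
Qed.

Let num_neq0 f n d : f != 0 -> d != 0 -> f * polyF d = polyF n -> n != 0.
Proof.
move=> f0 d0 e; have := mulf_neq0 f0 (_ : polyF d != 0).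
by rewrite e !polyF_eq0; exact.
Qed.

(** Multiplicativity of [W] and cross-multiplication show that any fraction representing [f] may be
    used in place of the one picked by [repr]; sums can then be treated over a common
    denominator. *)
Let omE f n d : f != 0 -> d != 0 -> f * polyF d = polyF n ->
  om f = og_sub (W n) (W d).
Proof.
move=> f0 d0 e; have n0 := num_neq0 f0 d0 e.
have D0 := denom_repr_neq0 f; have E := numden_repr f.
have N0 := num_neq0 f0 D0 E.
apply: og_subr_eq => //; rewrite -!/(W _) -!WM //; congr W; apply: polyF_inj.
by rewrite !rmorphM /= -E -e mulrAC.
Qed.

Lemma omega_frac_valuation : is_valuation om.
Proof.
split=> [f g f0 g0|f g f0 g0 fg0].
  have [Df Dg] := (denom_repr_neq0 f, denom_repr_neq0 g).
  have [Ef Eg] := (numden_repr f, numden_repr g).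
  rewrite (omE f0 Df Ef) (omE g0 Dg Eg) -og_subD //.
  rewrite -!WM ?(num_neq0 f0 Df Ef) ?(num_neq0 g0 Dg Eg) //.
  apply: (omE (mulf_neq0 f0 g0) (mulf_neq0 Df Dg)).
  by rewrite !rmorphM /= -Ef -Eg mulrACA.
have [Df Dg] := (denom_repr_neq0 f, denom_repr_neq0 g).
move: \d_(repr f) \d_(repr g) \n_(repr f) \n_(repr g) Df Dg
  (numden_repr f) (numden_repr g) => d e n m d0 e0 Ef Eg.
have de0 : d * e != 0 by rewrite mulf_neq0.
have Ef' : f * polyF (d * e) = polyF (n * e) by rewrite !rmorphM /= mulrA Ef.
have Eg' : g * polyF (d * e) = polyF (m * d).
  by rewrite !rmorphM /= mulrCA mulrC Eg.
have Efg : (f + g) * polyF (d * e) = polyF (n * e + m * d).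
  by rewrite rmorphD /= mulrDl Ef' Eg'.
rewrite (omE f0 de0 Ef') (omE g0 de0 Eg') (omE fg0 de0 Efg).
rewrite /og_sub !og_leD2r //; apply: WD.
- exact: num_neq0 f0 de0 Ef'.
- exact: num_neq0 g0 de0 Eg'.
- exact: num_neq0 fg0 de0 Efg.
Qed.

Lemma omega_frac_poly p : p != 0 ->
  om (polyF p) = gauss v emb xd (p \Po ('X + a%:P)).
Proof.
move=> p0; have F0 : polyF p != 0 by rewrite polyF_eq0.
by rewrite (omE F0 (oner_neq0 _) (esym (rmorphM _ p 1))) WM ?oner_neq0 // og_addrK.
Qed.

Lemma omega_poly_geP p z : p != 0 ->
  og_le z (om (polyF p)) <->
  forall n, (p \Po ('X + a%:P))`_n != 0 ->
    og_le z (og_add (emb (v (p \Po ('X + a%:P))`_n)) (og_muln n xd)).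
Proof.
move=> p0; rewrite omega_frac_poly //; split=> [h n pn|h].
  by apply: og_le_trans h _ => //; exact: gauss_le.
by apply: gauss_ge; rewrite // -/(sh p) sh_eq0.
Qed.

Lemma omega_poly_leP p z : p != 0 ->
  og_le (om (polyF p)) z <->
  exists n, (p \Po ('X + a%:P))`_n != 0 /\
    og_le (og_add (emb (v (p \Po ('X + a%:P))`_n)) (og_muln n xd)) z.
Proof.
move=> p0; rewrite omega_frac_poly //; split=> [h|[n [pn h]]].
  have [|n [pn e]] := gauss_ex v emb xd (_ : p \Po ('X + a%:P) != 0).
    by rewrite -/(sh p) sh_eq0.
  by exists n; split=> //; rewrite -[og_add _ _]e.
by apply: og_le_trans h => //; exact: gauss_le.
Qed.

Lemma omega_frac_const c : c != 0 -> om (constF c) = emb (v c).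
Proof.
move=> c0; have p0 : c%:P != 0 :> {poly L} by rewrite polyC_eq0.
apply: og_le_anti => //.
  apply/omega_poly_leP => //; exists 0; rewrite comp_polyC coefC eqxx og_addr0 //.
  by split=> //; exact: og_lexx.
apply/omega_poly_geP => // n; rewrite comp_polyC coefC.
by case: n => [_|n] /=; rewrite ?eqxx // og_addr0 //; exact: og_lexx.
Qed.

Let comp_lin c : ('X - c%:P) \Po ('X + a%:P) = 'X + (a - c)%:P.
Proof. by rewrite comp_polyB comp_polyX comp_polyC polyCB addrA. Qed.

(** Recentering sends [X - c] to [X + (a - c)], of value [min (x_delta, v (a - c))]. Describing the
    comparisons with this minimum, rather than the minimum itself, absorbs the case [a = c], where
    the constant term is absent. *)
Lemma omega_lin_geP c z :
  og_le z (om (polyF ('X - c%:P))) <->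
  og_le z xd /\ vge (emb \o v) z (a - c).
Proof.
rewrite omega_poly_geP ?polyXsubC_eq0 // comp_lin; split=> [h|[hx ha] n].
  split.
    have := h 1%N; rewrite coefD coefX coefC /= addr0 (valuation1 HG Hv) (emb0 HG HH Hemb).
    by rewrite og_add0r // og_addr0 // oner_eq0; apply.
  have [->|ne] := eqVneq a c; first by left; rewrite subrr.
  by right; have := h 0%N; rewrite coefD coefX coefC add0r og_addr0 // subr_eq0; apply.
rewrite coefD coefX coefC; case: n => [|[|n]] /=.
- rewrite add0r og_addr0 // subr_eq0.
  by case: ha => [/eqP|//]; rewrite subr_eq0 => ->.
- by rewrite addr0 (valuation1 HG Hv) (emb0 HG HH Hemb) og_add0r // og_addr0.
- by rewrite addr0 eqxx.
Qed.

Lemma omega_lin_leP c z :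
  og_le (om (polyF ('X - c%:P))) z <->
  og_le xd z \/ (a != c /\ og_le (emb (v (a - c))) z).
Proof.
rewrite omega_poly_leP ?polyXsubC_eq0 // comp_lin; split=> [[n]|].
  rewrite coefD coefX coefC; case: n => [|[|n]] /=.
  - by rewrite add0r og_addr0 // subr_eq0; right.
  - by rewrite addr0 (valuation1 HG Hv) (emb0 HG HH Hemb) og_add0r // og_addr0 // => -[]; left.
  - by rewrite addr0 eqxx => -[].
case=> [h|[ac h]].
  exists 1%N; rewrite coefD coefX coefC /= addr0 (valuation1 HG Hv) (emb0 HG HH Hemb).
  by rewrite og_add0r // og_addr0 // oner_eq0.
by exists 0%N; rewrite coefD coefX coefC add0r og_addr0 // subr_eq0.
Qed.

Lemma omega_center : om (polyF ('X - a%:P)) = xd.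
Proof.
apply: og_le_anti => //.
  by apply/omega_lin_leP; left; exact: og_lexx.
by apply/omega_lin_geP; split; [exact: og_lexx|left; exact: subrr].
Qed.
End Omega.

(* Since [L] is algebraically closed, a valuation of [L(x)] is determined by
   its values on constants and on the polynomials [x - c]. *)
Section Uniqueness.
Variables (L : closedFieldType) (H K : ogroup).
Variables (HH : is_ogroup H) (HK : is_ogroup K).
Variables (w : ratfun L -> H) (w' : ratfun L -> K).
Hypotheses (Hw : is_valuation w) (Hw' : is_valuation w').

(** It serves for two properties stable under products and inverses: agreement of two valuations,
    and having a constant leading part. *)
Lemma ratfun_ind (P : ratfun L -> Prop) :
  (forall c, c != 0 -> P (constF c)) ->
  (forall c, P (polyF ('X - c%:P))) ->
  (forall f g, f != 0 -> g != 0 -> P f -> P g -> P (f * g)) ->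
  (forall f, f != 0 -> P f -> P f^-1) ->
  forall f, f != 0 -> P f.
Proof.
move=> Pc Pl PM PV.
have Pp p : p != 0 -> P (polyF p).
  move=> p0; have [r e] := closed_field_poly_normal p.
  rewrite e -mul_polyC rmorphM /=; have lp : lead_coef p != 0 by rewrite lead_coef_eq0.
  have {e p0} main : polyF (\prod_(z <- r) ('X - z%:P)) != 0 /\
      P (polyF (\prod_(z <- r) ('X - z%:P))).
    elim: r {e} => [|z r [IH0 IH]].
      by rewrite big_nil -/(constF 1) constF_eq0 oner_eq0; split=> //; exact/Pc/oner_neq0.
    have z0 : polyF ('X - z%:P) != 0 by rewrite polyF_eq0 polyXsubC_eq0.
    rewrite big_cons polyFM; split; [exact: mulf_neq0 z0 IH0|].
    exact: (PM _ _ z0 IH0 (Pl z) IH).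
  case: main => q0 Pq; have lp' : constF (lead_coef p) != 0 by rewrite constF_eq0.
  exact: (PM _ _ lp' q0 (Pc _ lp) Pq).
move=> f f0; have D0 := denom_repr_neq0 f.
have PD0 : polyF \d_(repr f) != 0 by rewrite polyF_eq0.
have e : f = polyF \n_(repr f) * (polyF \d_(repr f))^-1.
  by rewrite -numden_repr mulfK.
have N0 : polyF \n_(repr f) != 0.
  by have := mulf_neq0 f0 PD0; rewrite numden_repr.
have N0' : \n_(repr f) != 0 by move: N0; rewrite polyF_eq0.
have PDV0 := invr_neq0 PD0.
by rewrite e; exact: (PM _ _ N0 PDV0 (Pp _ N0') (PV _ PD0 (Pp _ D0))).
Qed.

Variables (phi : H -> K).
Hypothesis phiE : is_oembedding phi.

Lemma valuation_unique :
  (forall c, c != 0 -> w' (constF c) = phi (w (constF c))) ->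
  (forall c, w' (polyF ('X - c%:P)) = phi (w (polyF ('X - c%:P)))) ->
  forall f, f != 0 -> w' f = phi (w f).
Proof.
move=> hc hl; apply: ratfun_ind => //.
  by move=> f g f0 g0 ef eg; 
    rewrite (valuationM Hw f0 g0) (valuationM Hw' f0 g0) ef eg (emb_add phiE).
move=> f f0 ef; rewrite (valuationV HH Hw f0) (valuationV HK Hw' f0) ef.
apply: (@og_addIr _ HK _ _ (phi (w f))).
by rewrite og_addNr // -(emb_add phiE) og_addNr // (emb0 HH HK phiE).
Qed.
End Uniqueness.

(** * Quasi-cuts read as comparisons with [x_delta] *)

Section QcutGroup.
Variables (G : ogroup) (HG : is_ogroup G).
Hypothesis Gdiv : forall (n : nat) (g : G), (0 < n)%N ->
  exists h, og_muln n h = g.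
Implicit Types (d : qcut G) (g : G).

(** [qgrp], [qemb] and [qx] are [Gamma(delta)], the inclusion of [Gamma] and [x_delta], for elements
    and cuts at once; most later arguments then avoid a case distinction. *)
Definition qgrp d : ogroup :=
  match d with QElt _ => G | QCut dl dr => cut_group dl dr end.

Definition qemb d : G -> qgrp d :=
  match d with QElt _ => id | QCut dl dr => fun g => (0 : int, g) end.

Definition qx d : qgrp d :=
  match d with QElt g => g | QCut dl dr => (1 : int, og_zero) end.

Lemma qgrp_is_ogroup d : is_qcut d -> is_ogroup (qgrp d).
Proof. by case: d => [//|dl dr] [h1 h2]; exact: cut_group_is_ogroup. Qed.

Lemma qemb_oembedding d : is_oembedding (@qemb d).
Proof.
case: d => [//|dl dr]; split=> [x y|x y] /=; first by rewrite addr0.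
exact: (iff_sym (og_sub_ge0 HG y x)).
Qed.

Lemma qemb_le_qx d g : is_qcut d -> og_le (qemb d g) (qx d) <-> qL d g.
Proof.
case: d => [//|dl dr] [h1 h2].
have -> : og_le (qemb (QCut dl dr) g) (qx (QCut dl dr)) <->
    cut_nonneg dl dr (1, og_sub og_zero g) by [].
rewrite /cut_nonneg /= /og_sub.
have e h : og_le og_zero (og_add (og_add h og_zero) (og_add og_zero (og_opp g)))
    <-> og_le g h by rewrite og_addr0 // og_add0r // og_sub_ge0.
split=> [[h [dh /e gh]]|dg]; first exact: (cut_down HG h1 h2 gh).
by exists g; split=> //; apply/e; exact: og_lexx.
Qed.

Lemma qx_le_qemb d g : is_qcut d -> og_le (qx d) (qemb d g) <-> qR d g.
Proof.
case: d => [//|dl dr] [h1 h2].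
have -> : og_le (qx (QCut dl dr)) (qemb (QCut dl dr) g) <->
    cut_nonneg dl dr (-1, og_sub g og_zero) by [].
rewrite /cut_nonneg /=.
split=> [[h [dh]]|dg].
  by rewrite og_addr0 // og_subr0 // => /(cut_up HG h1 h2); apply.
by exists g; rewrite og_addr0 // og_subr0 //; split=> //; exact: og_lexx.
Qed.

Lemma qcut_le_of_between d e g : is_qcut d -> is_qcut e ->
  qR d g -> qL e g -> qcut_le d e.
Proof.
move=> hd he; have [Hd He] := (qgrp_is_ogroup hd, qgrp_is_ogroup he).
move=> /qx_le_qemb -/(_ hd) dg /qemb_le_qx -/(_ he) eg; split=> x.
  move=> /qemb_le_qx -/(_ hd) xd; apply/qemb_le_qx => //.
  apply: og_le_trans eg => //; apply/emb_le; first exact: qemb_oembedding.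
  by apply/(emb_le (qemb_oembedding d)); exact: og_le_trans dg.
move=> /qx_le_qemb -/(_ he) ex; apply/qx_le_qemb => //.
apply: og_le_trans dg _ => //; apply/emb_le; first exact: qemb_oembedding.
by apply/(emb_le (qemb_oembedding e)); exact: og_le_trans ex.
Qed.

Lemma qLVqR d g : is_qcut d -> qL d g \/ qR d g.
Proof.
move=> hd; rewrite -qemb_le_qx // -qx_le_qemb //.
exact/og_le_total/qgrp_is_ogroup.
Qed.

(** If [qR d] and [qL e] had no common element, every element of [qL e] would be in [qL d] and every
    element of [qR d] in [qR e], because the two sides of a quasi-cut cover [Gamma]. *)
Lemma qcut_between d e : is_qcut d -> is_qcut e ->
  ~ qcut_le e d -> exists g, qR d g /\ qL e g.
Proof.
move=> hd he ne; apply: contrapT => no; apply: ne; split=> x hx.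
  have [//|h] := qLVqR x hd.
  by case: no; exists x.
have [h|//] := qLVqR x he.
by case: no; exists x.
Qed.

Lemma qcut_eqP d e : is_qcut d -> is_qcut e -> qcut_eq d e -> d = e.
Proof.
(* A cut cannot share both sides with an element [g]: then [g] would lie on both sides and be
   strictly below itself. *)
have no dl dr g : is_qcut (QCut dl dr) ->
    (forall x, dl x <-> og_le x g) -> (forall x, dr x <-> og_le g x) -> False.
  move=> [h _] /(_ g) [_ hl] /(_ g) [_ hr].
  by have [] := h _ _ (hl (og_lexx HG g)) (hr (og_lexx HG g)).
case: d e => [g|dl dr] [h|el er] hd he [hl hr].
- by congr QElt; apply: og_le_anti => //; apply/hl; exact: og_lexx.
- by case: (no _ _ g he) => x; [exact: iff_sym (hl x) | exact: iff_sym (hr x)].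
- by case: (no _ _ h hd) => x; [exact: hl | exact: hr].
- by congr QCut; apply: funext => x; apply: propext; [exact: hl | exact: hr].
Qed.

End QcutGroup.

(** * Pointed balls and change of center *)

Section Poset.
Variables (L : closedFieldType) (G : ogroup) (v : L -> G).
Hypotheses (HG : is_ogroup G) (Hv : is_valuation v).
Hypothesis Hgroup : forall g : G, exists a : L, a != 0 /\ v a = g.
Implicit Types (a b c : L) (d e : qcut G) (g : G).

Lemma value_group_divisible (n : nat) g : (0 < n)%N -> exists h, og_muln n h = g.
Proof.
move=> n0; have [c [c0 <-]] := Hgroup g.
(* The equation solved is [x ^ n = c], since the list [[:: c]] leaves only a constant term on the
   right. *)
have [x] := solve_monicpoly (nth 0 [:: c]) n0.
case: n n0 => // n _; rewrite big_ord_recl /= expr0 mulr1 big1 ?addr0.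
  move=> e; have x0 : x != 0.
    by apply/eqP => x0; case/eqP: c0; rewrite -e x0 expr0n.
  by exists (v x); rewrite -e; exact/esym/(valuationX HG Hv n.+1 x0).
by move=> i _; rewrite nth_nil mul0r.
Qed.

Let Gdiv := value_group_divisible.
Let Hq d (hd : is_qcut d) := qgrp_is_ogroup HG Gdiv hd.

Definition qomega a d : ratfun L -> qgrp d := omega_frac v (qemb d) (qx d) a.

Lemma omega_qomega a d : omega v a d = VX (qemb d) (@qomega a d).
Proof. by case: d. Qed.

Lemma qomega_valuation a d : is_qcut d -> is_valuation (@qomega a d).
Proof.
by move=> hd; apply: omega_frac_valuation => //; [exact: Hq | exact: qemb_oembedding].
Qed.

Lemma qomega_const a d c : is_qcut d -> c != 0 -> qomega a d (constF c) = qemb d (v c).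
Proof.
by move=> hd c0; apply: omega_frac_const => //; [exact: Hq | exact: qemb_oembedding].
Qed.

Lemma qomega_center a d : is_qcut d -> qomega a d (polyF ('X - a%:P)) = qx d.
Proof.
by move=> hd; apply: (omega_center HG) => //; [exact: Hq | exact: qemb_oembedding].
Qed.

Lemma qomega_lin_geP a d c (z : qgrp d) : is_qcut d ->
  og_le z (qomega a d (polyF ('X - c%:P))) <->
  og_le z (qx d) /\ vge (qemb d \o v) z (a - c).
Proof.
by move=> hd; apply: omega_lin_geP => //; [exact: Hq | exact: qemb_oembedding].
Qed.

Lemma qomega_lin_leP a d c (z : qgrp d) : is_qcut d ->
  og_le (qomega a d (polyF ('X - c%:P))) z <->
  og_le (qx d) z \/ (a != c /\ og_le (qemb d (v (a - c))) z).
Proof.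
by move=> hd; apply: omega_lin_leP => //; [exact: Hq | exact: qemb_oembedding].
Qed.

Let evD d x y : x != 0 -> y != 0 -> x + y != 0 ->
  og_le ((qemb d \o v) x) ((qemb d \o v) (x + y)) \/
  og_le ((qemb d \o v) y) ((qemb d \o v) (x + y)).
Proof.
by rewrite !(emb_le (qemb_oembedding HG d)); exact: valuationD.
Qed.

Let evN d x : x != 0 -> (qemb d \o v) (- x) = (qemb d \o v) x.
Proof. by move=> x0; rewrite /= (valuationN HG Hv). Qed.

(** In [Gamma(delta)] both shapes of ball become [x_delta <= v (c - a)]: for a cut, lying strictly
    above the left side means lying in the right side. *)
Lemma ballP a d c : is_qcut d ->
  ball v a d c <-> vge (qemb d \o v) (qx d) (c - a).
Proof.
move=> hd; have -> : ball v a d c <-> c = a \/ qR d (v (c - a)).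
  case: d hd => [//|dl dr] [h1 h2] /=; split=> -[e|h]; try by left.
    have [hl|] := h2 (v (c - a)); last by right.
    by case: (og_ltxx (h _ hl)).
  by right=> x xl; exact: h1.
rewrite /vge /= qx_le_qemb //; split=> -[e|h]; try by right.
  by left; rewrite e subrr.
by left; apply/eqP; rewrite -subr_eq0 e.
Qed.

Lemma ballxx a d : is_qcut d -> ball v a d a.
Proof. by move=> hd; apply/ballP => //; left; rewrite subrr. Qed.

Lemma ball_sym a d b : is_qcut d -> ball v a d b -> ball v b d a.
Proof.
by move=> hd /(ballP _ _ hd)/(vgeN (@evN d)); rewrite opprB => /(ballP _ _ hd).
Qed.

(** By the ultrametric inequality, once [delta <= epsilon] the smaller ball is contained in the
    larger one as soon as its center is. *)
Lemma pball_leP a b d e : is_qcut d -> is_qcut e ->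
  pball_le v a d b e <-> qcut_le d e /\ ball v a d b.
Proof.
move=> hd he; split=> [[h1 h2]|[de ab]]; first by split=> //; apply/h1/ballxx.
split=> // c /(ballP _ _ he) bc; apply/(ballP _ _ hd).
rewrite -(subrKA b); apply: (vgeD (Hq hd) (@evD d)); last exact/(ballP _ _ hd).
case: bc => [e0|bc]; [by left | right].
by apply/qx_le_qemb => //; case: de => _; apply; apply/qx_le_qemb.
Qed.

Lemma pball_eqP a b d e :
  pball_eq v a d b e <-> pball_le v a d b e /\ pball_le v b e a d.
Proof.
split=> [[h1 [h2 h3]]|[[h1 [h2 h3]] [h4 [h5 h6]]]].
  by split; split; try split=> x; try (move=> x); rewrite ?h1 ?h2 ?h3.
by split=> [c|]; [split; [exact: h4|exact: h1] | split=> x; split; auto].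
Qed.

(** When [v (b - a) >= x_delta], replacing [a] by [b] does not change [min (x_delta, v (a - c))] for
    any [c], and these values determine the valuation. *)
Lemma qomega_change_center a b d f : is_qcut d -> ball v a d b -> f != 0 ->
  qomega b d f = qomega a d f.
Proof.
move=> hd ab; have HH := Hq hd; have Hi : is_oembedding (@id (qgrp d)) by [].
apply: (valuation_unique HH HH (qomega_valuation a hd) (qomega_valuation b hd) Hi) => c.
  by move=> c0; rewrite !qomega_const.
have main a' b' : ball v a' d b' ->
    og_le (qomega a' d (polyF ('X - c%:P))) (qomega b' d (polyF ('X - c%:P))).
  move=> /(ballP _ _ hd) ab'.
  have /(qomega_lin_geP _ _ _ hd)[h1 h2] := og_lexx HH (qomega a' d (polyF ('X - c%:P))).
  apply/(qomega_lin_geP _ _ _ hd); split=> //.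
  rewrite -(subrKA a'); apply: (vgeD HH (@evD d)) => //.
  by case: ab' => [|h]; [left | right; exact: og_le_trans h].
by apply: og_le_anti => //; apply: main => //; exact: ball_sym.
Qed.

(** * Valuation-transcendence of [omega_{a,delta}] *)

Lemma omega_ext_val a d : is_qcut d -> is_ext_val v (omega v a d).
Proof.
move=> hd; rewrite omega_qomega; split=> /=;
  [exact: Hq|exact: qemb_oembedding|exact: qomega_valuation|].
by move=> c c0; exact: qomega_const.
Qed.

(** For a cut, [n x_delta] has first coordinate [n], so no positive multiple falls in [Gamma]. For
    an element [g = v c], the polynomial [r = (X - a) / c] has value 0, and the [i]-th coefficient
    of [P(r)] around [a] is [P_i / c ^ i]. Its term has value [v P_i - i g + i g], so a unit
    coefficient of [P] bounds the value of [P(r)] by 0. *)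
Lemma omega_valuation_trans a d : is_qcut d -> valuation_trans v (omega v a d).
Proof.
rewrite omega_qomega => hd.
have Ha0 : polyF ('X - a%:P) != 0 by rewrite polyF_eq0 polyXsubC_eq0.
have he := qomega_center a hd.
case: d hd he => [g|dl dr] hd he; [left|right]; last first.
  exists (polyF ('X - a%:P)); split=> // n g n0; rewrite /= he => e.
  have h m : (og_muln m (qx (QCut dl dr)) : int * G).1 = m.
    by elim: m => [|m IH] //=; rewrite IH; lia.
  by move/(congr1 fst): e n0; rewrite h /= => -[->].
have [c [c0 cg]] := Hgroup g.
have HH := Hq hd; have Hw := qomega_valuation a hd.
have ci0 : c^-1 != 0 by rewrite invr_eq0.
pose r := c^-1 *: ('X - a%:P).
have er : polyF r = constF c^-1 * polyF ('X - a%:P) by rewrite /r -mul_polyC polyFM.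
exists (polyF r); split.
  by rewrite polyF_eq0 scaler_eq0 negb_or ci0 polyXsubC_eq0.
split.
  rewrite er /= (valuationM Hw) ?constF_eq0 // he qomega_const // (valuationV HG Hv) //= cg.
  by rewrite og_addNr //; exact: og_lexx.
move=> P _ [i [Pi vPi]].
have P0 : P != 0 by apply: contraNneq Pi => ->; rewrite coef0.
have sh : (P \Po r) \Po ('X + a%:P) = P \Po (c^-1 *: 'X).
  rewrite -comp_polyA; congr (P \Po _).
  by rewrite /r comp_polyZ comp_polyB comp_polyX comp_polyC addrK.
have coef : ((P \Po r) \Po ('X + a%:P))`_i = P`_i * c^-1 ^+ i.
  rewrite sh comp_polyE (eq_bigr (fun j : 'I_(size P) => (P`_j * c^-1 ^+ j) *: 'X^j)).
    rewrite -(poly_def (size P) (fun j => P`_j * c^-1 ^+ j)) coef_poly.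
    by case: ltnP => // le_Pi; rewrite nth_default // eqxx in Pi.
  by move=> j _; rewrite exprZn scalerA.
have cin0 : c^-1 ^+ i != 0 by rewrite expf_neq0.
have coef0 : ((P \Po r) \Po ('X + a%:P))`_i != 0 by rewrite coef mulf_neq0.
have Pr0 : P \Po r != 0.
  by apply: contraNneq coef0 => ->; rewrite comp_poly0 coef0.
rewrite evalF_polyF; split; first by rewrite polyF_eq0.
apply/(omega_poly_leP HG HH Hv (qemb_oembedding HG _) _ a _ Pr0).
exists i; split=> //; rewrite coef (valuationM Hv) // vPi og_add0r //=.
rewrite (valuationX HG Hv) // (valuationV HG Hv) // cg -og_mulnDr //.
by rewrite og_addNr // og_muln0 //; exact: og_lexx.
Qed.

(** * Equivalence and order of valuations against equality and order of balls *)

Lemma ext_val_cmp (mu : vx L G) f c : is_ext_val v mu -> f != 0 -> c != 0 ->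
  (og_le og_zero (vval mu (f * (constF c)^-1)) <->
     og_le (vemb mu (v c)) (vval mu f)) /\
  (og_le og_zero (vval mu (constF c * f^-1)) <->
     og_le (vval mu f) (vemb mu (v c))).
Proof.
move=> [HM _ Hw hc] f0 c0; have c0' : constF c != 0 by rewrite constF_eq0.
have [ci0 fi0] := (invr_neq0 c0', invr_neq0 f0).
rewrite (valuationM Hw f0 ci0) (valuationM Hw c0' fi0).
rewrite (valuationV HM Hw c0') (valuationV HM Hw f0) (hc _ c0).
by split; exact: og_sub_ge0.
Qed.

Lemma vequiv_cmp (mu nu : vx L G) f g : is_ext_val v mu -> is_ext_val v nu ->
  vequiv mu nu -> f != 0 ->
  (og_le (vemb mu g) (vval mu f) <-> og_le (vemb nu g) (vval nu f)) /\
  (og_le (vval mu f) (vemb mu g) <-> og_le (vval nu f) (vemb nu g)).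
Proof.
move=> hm hn e f0; have [c [c0 <-]] := Hgroup g.
have c0' : constF c != 0 by rewrite constF_eq0.
have [m1 m2] := ext_val_cmp hm f0 c0; have [n1 n2] := ext_val_cmp hn f0 c0.
rewrite -m1 -m2 -n1 -n2; split; apply: e.
  exact: mulf_neq0 f0 (invr_neq0 c0').
exact: mulf_neq0 c0' (invr_neq0 f0).
Qed.

(** The polynomial [X - a] suffices: its two values are [x_delta] and [min (x_epsilon, v (b - a))].
    Comparing them with all of [Gamma] gives [delta <= epsilon], and comparing with [v (b - a)] puts
    [b] in the ball around [a]. *)
Lemma pball_le_of_vequiv a b d e : is_qcut d -> is_qcut e ->
  vequiv (omega v a d) (omega v b e) -> pball_le v a d b e.
Proof.
move=> hd he; have := @vequiv_cmp (omega v a d) (omega v b e) (polyF ('X - a%:P)) _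
  (omega_ext_val a hd) (omega_ext_val b he).
rewrite !omega_qomega /= => h eq; have Ha0 : polyF ('X - a%:P) != 0.
  by rewrite polyF_eq0 polyXsubC_eq0.
have {h eq} h g := h g eq Ha0.
apply/pball_leP => //; split; first split=> g.
- have [h1 _] := h g.
  move=> /(qemb_le_qx HG _ hd); rewrite -(qomega_center a hd) => /h1.
  by case/(qomega_lin_geP _ _ _ he) => /(qemb_le_qx HG _ he).
- have [_ h2] := h g.
  move=> /(qx_le_qemb HG _ he) eg; apply/(qx_le_qemb HG _ hd).
  by rewrite -(qomega_center a hd); apply/h2/(qomega_lin_leP _ _ _ he); left.
have [->|ne] := eqVneq b a; first exact: ballxx.
apply/(ballP _ _ hd); right; rewrite -(qomega_center a hd) /=.
have [_ h2] := h (v (b - a)).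
by apply/h2/(qomega_lin_leP _ _ _ he); right; split=> //; exact/og_lexx/Hq.
Qed.

Lemma vequiv_sym (mu nu : vx L G) : vequiv mu nu -> vequiv nu mu.
Proof. by move=> h f f0; apply: iff_sym; exact: h. Qed.

Lemma pball_eq_vequiv a b d e : is_qcut d -> is_qcut e ->
  pball_eq v a d b e <-> vequiv (omega v a d) (omega v b e).
Proof.
move=> hd he; split=> [|h]; last first.
  by apply/pball_eqP; split; apply: pball_le_of_vequiv => //; exact: vequiv_sym.
move=> /[dup] /pball_eqP[/(pball_leP _ _ hd he)[_ ab] _] [_ /(qcut_eqP HG hd he) ed].
case: e / ed he => _; rewrite !omega_qomega => f f0 /=.
by rewrite (qomega_change_center hd ab).
Qed.

(** Every term [v f_n + n x] is monotone in [x], so the minimum can only grow when [x_delta] is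
    replaced by [g] and [g] by [x_epsilon]. The witness is the value at [g], which lies in
    [Gamma]. *)
Lemma qomega_between b d e g (f : {poly L}) : is_qcut d -> is_qcut e ->
  qR d g -> qL e g -> f != 0 ->
  exists h, og_le (qomega b d (polyF f)) (qemb d h) /\
            og_le (qemb e h) (qomega b e (polyF f)).
Proof.
move=> hd he dg eg f0; pose w := omega_frac v id g b.
have Hid : is_oembedding (id : G -> G) by [].
exists (w (polyF f)); split.
  have [+ _] := omega_poly_leP HG HG Hv Hid g b (w (polyF f)) f0.
  case=> [|n [fn hn]]; first exact: og_lexx.
  apply/(omega_poly_leP HG (Hq hd) Hv (qemb_oembedding HG d) _ b _ f0).
  exists n; split=> //.
  apply: (@og_le_trans _ (Hq hd)
    (qemb d (og_add (v (f \Po ('X + b%:P))`_n) (og_muln n g)))).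
    2: exact/(emb_le (qemb_oembedding HG d)).
  rewrite (emb_add (qemb_oembedding HG d)); apply/(og_leD2l (Hq hd)).
  rewrite (emb_muln HG (Hq hd) (qemb_oembedding HG d)).
  by apply/(og_muln_le (Hq hd))/(qx_le_qemb HG).
have [+ _] := omega_poly_geP HG HG Hv Hid g b (w (polyF f)) f0.
move=> hn; apply/(omega_poly_geP HG (Hq he) Hv (qemb_oembedding HG e) _ b _ f0) => n fn.
apply: (@og_le_trans _ (Hq he)
  (qemb e (og_add (v (f \Po ('X + b%:P))`_n) (og_muln n g)))).
  by apply/(emb_le (qemb_oembedding HG e))/hn => //; exact: og_lexx.
rewrite (emb_add (qemb_oembedding HG e)); apply/(og_leD2l (Hq he)).
rewrite (emb_muln HG (Hq he) (qemb_oembedding HG e)).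
by apply/(og_muln_le (Hq he))/(qemb_le_qx HG).
Qed.

Lemma pball_le_vle a b d e : is_qcut d -> is_qcut e ->
  pball_le v a d b e <-> vle (omega v a d) (omega v b e).
Proof.
move=> hd he; split=> [/(pball_leP _ _ hd he)[de ab]|[|h]].
- have [ed|/(qcut_between HG Gdiv hd he)[g [dg eg]]] := EM (qcut_le e d).
    left; apply/pball_eq_vequiv => //; apply/pball_eqP; split; apply/pball_leP => //.
    split=> //; have ee : d = e.
      by apply: (qcut_eqP HG) => //; case: de ed => [? ?] [? ?]; split=> x; split; auto.
    by rewrite -ee; exact: ball_sym.
  right=> f f0; rewrite !omega_qomega /=.
  have F0 : polyF f != 0 by rewrite polyF_eq0.
  (* Since [b] is also a center of the larger ball, only the radii remain to be compared. *)
  by rewrite -(qomega_change_center hd ab F0); exact: (qomega_between b hd he dg eg f0).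
- exact: pball_le_of_vequiv.
(* On this polynomial the hypothesis reads [x_delta <= g <= min (x_epsilon, v (b - a))]. *)
have := h ('X - a%:P); rewrite polyXsubC_eq0 !omega_qomega /= => /(_ isT)[g].
rewrite (qomega_center a hd) => -[/(qx_le_qemb HG _ hd) dg /(qomega_lin_geP _ _ _ he)].
move=> [/(qemb_le_qx HG _ he) eg bg].
apply/pball_leP => //; split; first exact: (qcut_le_of_between HG Gdiv hd he dg eg).
apply/(ballP _ _ hd); case: bg => [e0|/(emb_le (qemb_oembedding HG e)) bg]; first by left.
right; apply: (og_le_trans (Hq hd)); first exact/(qx_le_qemb HG _ hd)/dg.
exact/(emb_le (qemb_oembedding HG d)).
Qed.

(** * Surjectivity onto the equivalence classes *)

Section Surjectivity.
Variable mu : vx L G.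
Hypothesis Hmu : is_ext_val v mu.

Let HM : is_ogroup (vgrp mu). Proof. by case: Hmu. Qed.
Let Hemb : is_oembedding (vemb mu). Proof. by case: Hmu. Qed.
Let Hw : is_valuation (vval mu). Proof. by case: Hmu. Qed.
Let Hconst c : c != 0 -> vval mu (constF c) = vemb mu (v c).
Proof. by case: Hmu => _ _ _; apply. Qed.
Let lin0 c : polyF ('X - c%:P) != 0 :> ratfun L.
Proof. by rewrite polyF_eq0 polyXsubC_eq0. Qed.
Let linE a c : polyF ('X - a%:P) + constF (a - c) = polyF ('X - c%:P).
Proof. by rewrite /constF -rmorphD /= polyCB addrA subrK. Qed.

Definition best_center a :=
  forall c, og_le (vval mu (polyF ('X - c%:P))) (vval mu (polyF ('X - a%:P))).

(** Write [X - c] as [(X - a) + (a - c)]. If [v (a - c) < x_delta], the strict ultrametric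
    inequality fixes the value. Otherwise it only gives a value at least that of [X - a], and the
    maximality of [a] excludes a larger one. *)
Lemma vequiv_of_best_center a d (phi : qgrp d -> vgrp mu) :
  is_qcut d -> is_oembedding phi ->
  (forall g, phi (qemb d g) = vemb mu g) ->
  phi (qx d) = vval mu (polyF ('X - a%:P)) ->
  best_center a -> vequiv mu (omega v a d).
Proof.
move=> hd Hphi phi_emb phi_x best f f0; rewrite omega_qomega /=.
have HH := Hq hd.
rewrite (valuation_unique HH HM (qomega_valuation a hd) Hw Hphi _ _ f0).
- by rewrite -(emb0 HH HM Hphi); exact: emb_le.
- by move=> c c0; rewrite Hconst // qomega_const.
move=> c; have [<-|ac] := eqVneq a c; first by rewrite qomega_center.
have ac0 : a - c != 0 by rewrite subr_eq0.
have cac0 : constF (a - c) != 0 by rewrite constF_eq0.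
have [h|h] := og_leVlt HH (qx d) (qemb d (v (a - c))).
  have -> : qomega a d (polyF ('X - c%:P)) = qx d.
    apply: og_le_anti => //.
      by apply/qomega_lin_leP => //; left; exact: og_lexx.
    by apply/qomega_lin_geP => //; split; [exact: og_lexx | right].
  rewrite phi_x; apply: og_le_anti => //.
  have : og_le (vval mu (polyF ('X - a%:P))) (vval mu (constF (a - c))).
    by rewrite Hconst // -phi_x -phi_emb; apply/emb_le.
  have := valuationD Hw (lin0 a) cac0; rewrite linE => /(_ (lin0 c))[//|h1 h2].
  exact: og_le_trans h1.
have -> : qomega a d (polyF ('X - c%:P)) = qemb d (v (a - c)).
  apply: og_le_anti => //.
    by apply/qomega_lin_leP => //; right; split=> //; exact: og_lexx.
  by apply/qomega_lin_geP => //; split; [exact: og_ltW | right; exact: og_lexx].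
rewrite phi_emb -Hconst //.
have [|_] := val_add_gt HM (valuationD Hw) (valuationN HM Hw) cac0 (y := polyF ('X - a%:P)).
  by right; rewrite Hconst // -phi_x -phi_emb; apply/(emb_lt HH HM Hphi).
by rewrite addrC linE.
Qed.

Section CutEmbedding.
Variable y : vgrp mu.
Hypothesis y_out : forall g, y <> vemb mu g.

Let dl g := og_lt (vemb mu g) y.
Let dr g := og_lt y (vemb mu g).
Let phi (z : cut_group dl dr) : vgrp mu :=
  og_add (og_mulz (z : int * G).1 y) (vemb mu (z : int * G).2).

Lemma cut_of_value_is_qcut : is_qcut (QCut dl dr).
Proof.
split=> [x z hx hz|x].
  by apply/(emb_lt HG HM Hemb); apply: og_lt_le_trans hx _ => //; exact: og_ltW.
have [h|h] := og_le_total HM (vemb mu x) y; [left|right]; split=> // e.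
by case: (y_out (esym e)).
Qed.

Let phiD (z w : cut_group dl dr) : phi (og_add z w) = og_add (phi z) (phi w).
Proof. by rewrite /phi /= og_mulzDl // (emb_add Hemb) og_addACA. Qed.

Let phi_ge0 (z : int * G) : cut_nonneg dl dr z -> og_le og_zero (phi z).
Proof.
case: z => k b; rewrite /phi /=; case: (ltgtP k 0) => [k0|k0|->].
- move=> [g [dg gb]].
  rewrite -[k]opprK og_mulzN // og_addC // -/(og_sub _ _) og_sub_ge0 //.
  apply: (@og_le_trans _ HM (vemb mu (og_mulz (- k) g))); last exact/emb_le.
  rewrite (emb_mulz HG HM Hemb); apply: og_mulz_le => //; first by rewrite oppr_ge0 ltW.
  exact: og_ltW.
- move=> [g [dg gb]].
  apply: (@og_le_trans _ HM (vemb mu (og_add (og_mulz k g) b))).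
    by rewrite -(emb0 HG HM Hemb); apply/emb_le.
  rewrite (emb_add Hemb); apply/og_leD2r => //.
  rewrite (emb_mulz HG HM Hemb); apply: og_mulz_le => //; first exact: ltW.
  exact: og_ltW.
- by move=> b0; rewrite og_add0r // -(emb0 HG HM Hemb); apply/emb_le.
Qed.

(** As [Gamma] is divisible and the value group of [mu] has no torsion, a positive multiple of [y]
    in [Gamma] would put [y] in [Gamma]; so [k y + b = 0] forces [k = 0]. *)
Let phi_inj : injective phi.
Proof.
have out n g : (0 < n)%N -> og_muln n y <> vemb mu g.
  move=> n0; have [h <-] := Gdiv g n0.
  by rewrite (emb_muln HG HM Hemb) => /(og_muln_inj HM n0); exact: y_out.
have ker k (b : G) : phi (k, b) = og_zero -> k = 0.
  case: k => [[|n]|n] //; rewrite /phi /og_mulz /= => e; exfalso.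
    apply: (@out n.+1 (og_opp b)) => //; apply: (@og_addIr _ HM _ _ (vemb mu b)).
    by rewrite -(emb_add Hemb) og_addNr // (emb0 HG HM Hemb).
  apply: (@out n.+1 b) => //; rewrite -[LHS](og_opprK HM).
  apply: (@og_addIr _ HM _ _ (og_opp (og_muln n.+1 y))).
  by rewrite og_addNr // og_addC.
have HK := Hq cut_of_value_is_qcut.
move=> z w e; have e0 : phi (og_sub z w) = og_zero.
  by apply: (@og_addIr _ HM _ _ (phi w)); rewrite -phiD (og_subrK HK) og_add0r.
apply: (@og_addIr _ HK _ _ (og_opp w)); rewrite -!/(og_sub _ _) (og_subrr HK).
move: (og_sub z w) e0 => [k b] e0; have k0 := ker _ _ e0; rewrite k0 in e0 *.
congr pair; apply: (emb_inj HG HM Hemb); rewrite (emb0 HG HM Hemb).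
by move: e0; rewrite /phi /= og_add0r.
Qed.

Lemma cut_embedding : exists phi : cut_group dl dr -> vgrp mu,
  [/\ is_oembedding phi, forall g, phi (qemb (QCut dl dr) g) = vemb mu g &
      phi (qx (QCut dl dr)) = y].
Proof.
have HK := Hq cut_of_value_is_qcut.
have mono (z w : cut_group dl dr) : og_le z w -> og_le (phi z) (phi w).
  move=> zw; rewrite -(og_subrK HK w z) phiD -[X in og_le X _](og_add0r HM).
  by apply/og_leD2r => //; exact: phi_ge0.
exists phi; split.
- split=> // z w; split; first exact: mono.
  (* A monotone injection from a total order also reflects the order. *)
  move=> h; have [//|wz] := og_le_total HK z w.
  have e := phi_inj (og_le_anti HM h (mono _ _ wz)).
  by rewrite e; exact: og_lexx.
- by move=> g; rewrite /phi /= og_add0r.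
- by rewrite /phi /= og_addr0 // (emb0 HG HM Hemb) og_addr0.
Qed.
End CutEmbedding.

(* If every [x - a] is improved by some [x - c], it has leading part [c - a],
   so every rational function has a constant leading part, and [mu] is an
   immediate extension. *)
Lemma exists_best_center : valuation_trans v mu -> exists a, best_center a.
Proof.
move=> vt; apply: contrapT => no.
pose leading f := exists u, u != 0 /\ approx (vval mu) f (constF u).
have approx_const : forall f : ratfun L, f != 0 -> leading f.
  apply: ratfun_ind => [c c0|a|f g f0 g0 [u [u0 fu]] [t [t0 gt]]|f f0 [u [u0 fu]]].
  - by exists c; split=> //; split; [rewrite constF_eq0 | left; exact: subrr].
  - have [c /(og_ltNge HM) ac] : exists c, ~ og_le (vval mu (polyF ('X - c%:P)))
        (vval mu (polyF ('X - a%:P))).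
      by apply/existsNP => h; apply: no; exists a.
    have ca0 : c - a != 0.
      by rewrite subr_eq0; apply/eqP => e; move: ac; rewrite e; exact: og_ltxx.
    exists (c - a); split=> //; split; first by rewrite constF_eq0.
    by right; rewrite -(linE a c) -[c - a]opprB rmorphN /= opprK in ac *.
  - exists (u * t); split; first exact: mulf_neq0.
    by rewrite rmorphM; exact: (approxM HM Hw f0 g0 fu gt).
  exists u^-1; split; first exact: invr_neq0.
  by rewrite fmorphV; exact: (approxV HM Hw f0 fu).
case: vt => [[f [f0 [fge hf]]]|[f [f0 hf]]].
  have [u [u0 fu]] := approx_const f f0; have vu := approx_val HM Hw f0 fu.
  (* The test polynomial is [X - u], integral because [v u = mu f >= 0]. Its value at [f] exceeds
     [mu f], hence is positive, against residue-transcendence. *)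
  have integral i : ('X - u%:P)`_i != 0 -> og_le og_zero (v ('X - u%:P)`_i).
    case: i => [|[|i]]; rewrite coefB coefX coefC /= ?subr0 ?sub0r ?eqxx //.
      move=> _; rewrite (valuationN HG Hv) //; apply/(emb_le Hemb).
      by rewrite (emb0 HG HM Hemb) -Hconst // vu.
    by rewrite (valuation1 HG Hv) => _; exact: og_lexx.
  have unit_coef : exists i, ('X - u%:P)`_i != 0 /\ v ('X - u%:P)`_i = og_zero.
    exists 1%N; rewrite coefB coefX coefC /= subr0 oner_eq0.
    by rewrite (valuation1 HG Hv).
  have [] := hf _ integral unit_coef.
  have -> : evalF ('X - u%:P) f = f - constF u.
    by rewrite /evalF rmorphB /= map_polyX map_polyC /= hornerXsubC.
  case: fu => _ [e|h] ne le0; first by rewrite e eqxx in ne.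
  by case: (og_ltxx (og_lt_le_trans HM h (og_le_trans HM le0 fge))).
have [u [u0 fu]] := approx_const f f0.
(* Here [mu f] itself equals the value [v u] of a constant, so multiplicity 1 already contradicts
   value-transcendence. *)
apply: (hf 1%N (v u)) => //=.
by rewrite og_addr0 // -Hconst // (approx_val HM Hw f0 fu).
Qed.

Lemma omega_surjective : valuation_trans v mu ->
  exists a d, is_qcut d /\ vequiv mu (omega v a d).
Proof.
move=> /exists_best_center[a best]; exists a.
pose y := vval mu (polyF ('X - a%:P)).
have [[g yg]|no] := EM (exists g, y = vemb mu g).
  exists (QElt g); split=> //.
  exact: (@vequiv_of_best_center a (QElt g) (vemb mu)).
have out g : y <> vemb mu g by move=> e; apply: no; exists g.
have [phi [h1 h2 h3]] := cut_embedding out.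
exists (QCut (fun g => og_lt (vemb mu g) y) (fun g => og_lt y (vemb mu g))).
have hq := cut_of_value_is_qcut out; split=> //.
exact: (vequiv_of_best_center hq h1 h2 h3 best).
Qed.
End Surjectivity.

End Poset.

Theorem theorem2p8 (L : closedFieldType) (G : ogroup) (v : L -> G)
  (HG : is_ogroup G) (Hv : is_valuation v)
  (Hgroup : forall g : G, exists a : L, a != 0 /\ v a = g) :
  (* the map lands in V_fin(Kbar) *)
  (forall (a : L) (d : qcut G), is_qcut d ->
     is_ext_val v (omega v a d) /\ valuation_trans v (omega v a d)) /\
  (* it is well defined on pointed balls and injective *)
  (forall (a b : L) (d e : qcut G), is_qcut d -> is_qcut e ->
     (pball_eq v a d b e <-> vequiv (omega v a d) (omega v b e))) /\
  (* it preserves and reflects the order *)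
  (forall (a b : L) (d e : qcut G), is_qcut d -> is_qcut e ->
     (pball_le v a d b e <-> vle (omega v a d) (omega v b e))) /\
  (* it is surjective onto the equivalence classes *)
  (forall mu : vx L G, is_ext_val v mu -> valuation_trans v mu ->
     exists (a : L) (d : qcut G), is_qcut d /\ vequiv mu (omega v a d)).
Proof.
split; [|split; [|split]].
- by move=> a d hd; split; [exact: omega_ext_val | exact: omega_valuation_trans].
- by move=> a b d e; exact: pball_eq_vequiv.
- by move=> a b d e; exact: pball_le_vle.
- by move=> mu; exact: omega_surjective.
Qed.
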